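(* Let $d>3$ be an integer and write $n=\lfloor d/2\rfloor$. If $d=2n$, let $S_d\subset\mathbb{K}P^3$ be the surface $\sum_{j=0}^n t^{-j(j+1)}(\det A)^{n-j}f_{2j}(A)=0$, where each $f_{2j}$ is a homogeneous complex polynomial of degree $2j$ in the entries of a $2\times2$ matrix, not divisible by $\det$; if $d=2n+1$, let $S_d\subset\mathbb{K}P^3$ be the surface $\sum_{j=0}^n t^{-j(j+1)}(\det A)^{n-j}f_{2j+1}(A)=0$, where each $f_{2j+1}$ is a homogeneous complex polynomial of degree $2j+1$, not divisible by $\det$. Suppose all the polynomials $f_j$ are generic. Then there is no line $L\subset\mathbb{K}P^3$ such that $\operatorname{VAL}(L)\subset\operatorname{VAL}(S_d)$.
   Context: ''Generic'' means that the tuple of coefficients of the polynomials $f_j$ lies outside some proper Zariski-closed subset of the corresponding coefficient space. For a $2\times 2$ matrix $B=\begin{pmatrix}a&b\\ c&d\end{pmatrix}$ write $B^{\mathbf c}=\begin{pmatrix}d&-b\\ -c&a\end{pmatrix}$; $B^*$ is the conjugate transpose. $\mathbb{C}P^3$ is the projectivization of the space of complex $2\times2$ matrices and $[B]_{\mathbb{C}^*}$ the class of a nonzero matrix. $\mathbb{K}$ is the field of Puiseux series in $t$ (with $t\to\infty$) with complex coefficients, i.e. series $\sum_q a_q t^q$ with $a_q\in\mathbb{C}$ and exponents in $\frac1N\mathbb{Z}$ for some $N\ge1$, bounded above. $\mathbb{K}P^3$ is the projectivization of the space of $2\times 2$ matrices over $\mathbb{K}$. Every nonzero matrix $A$ over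 $\mathbb{K}$ can be written uniquely as $A=t^\alpha B+(\text{terms with exponents}<\alpha)$ with $\alpha\in\mathbb{Q}$ and $B$ a nonzero complex matrix. The map $\operatorname{VAL}\colon\mathbb{K}P^3\to\mathbb{C}P^3$ is: if $\det A=0$, $\operatorname{VAL}([A])=[B]_{\mathbb{C}^*}$; if $\det A\ne0$, rescale $A$ so that $\det A=1$ (then $\alpha\ge0$), and set $\operatorname{VAL}([A])=[e^\alpha B+e^{-\alpha}(B^{\mathbf c})^*]_{\mathbb{C}^*}$. For a subset $X\subset\mathbb{K}P^3$, $\operatorname{VAL}(X)$ is its image (no closure is taken). *)

(* Defs.v *)
From HB Require Import structures.
From mathcomp Require Import all_boot all_order all_algebra.
From mathcomp Require Import boolp classical_sets fsbigop.
From mathcomp Require Import complex.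
From mathcomp Require Import Rstruct.
From mathcomp Require Import mpoly.
From Stdlib Require Rtrigo_def ClassicalEpsilon.

Set Implicit Arguments.
Unset Strict Implicit.
Unset Printing Implicit Defensive.
Import GRing.Theory Num.Theory.
Local Open Scope ring_scope.

Definition Cx : numClosedFieldType := (Rdefinitions.R)[i].

(** * The field K of Puiseux series in t (t -> oo) with complex coefficients.
    A series  sum_q a_q t^q  is represented by its coefficient function
    a : rat -> C.  It is a Puiseux series iff its exponents lie in (1/N)Z
    for some N >= 1 and are bounded above. *)
Definition K := rat -> Cx.

Definition is_puiseux (a : K) : Prop :=
  (exists N : nat, (0 < N)%N /\
     forall q : rat, a q != 0 -> exists k : int, q = k%:~R / N%:R) /\
  (exists M : rat, forall q : rat, a q != 0 -> q <= M).

Definition K0 : K := fun _ => 0.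
Definition Kconst (c : Cx) : K := fun q => if q == 0 then c else 0.
Definition K1 : K := Kconst 1.
Definition Kt (e : rat) : K := fun q => if q == e then 1 else 0.
Definition Kadd (a b : K) : K := fun q => a q + b q.
Definition Kopp (a : K) : K := fun q => - a q.
(** Cauchy product; for Puiseux series the sum has finite support. *)
Definition Kmul (a b : K) : K :=
  fun q => \sum_(p \in [set: rat]) a p * b (q - p).
Definition Kpow (a : K) (k : nat) : K := iter k (Kmul a) K1.

Definition Kmx_puiseux (A : 'M[K]_2) : Prop := forall i j, is_puiseux (A i j).
Definition Kmx_nz (A : 'M[K]_2) : Prop := exists i j, A i j <> K0.
Definition Kscale (l : K) (A : 'M[K]_2) : 'M[K]_2 :=
  \matrix_(i, j) Kmul l (A i j).
Definition Kmxadd (A B : 'M[K]_2) : 'M[K]_2 := \matrix_(i, j) Kadd (A i j) (B i j).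

Definition i0 : 'I_2 := ord0.
Definition i1 : 'I_2 := ord_max.

Definition Kdet (A : 'M[K]_2) : K :=
  Kadd (Kmul (A i0 i0) (A i1 i1)) (Kopp (Kmul (A i0 i1) (A i1 i0))).

(** * Complex polynomials in the 4 entries of a 2x2 matrix.
    Variable i : 'I_4 stands for the entry (i %/ 2, i %% 2), i.e.
    X_0 = a, X_1 = b, X_2 = c, X_3 = d for the matrix (a b; c d). *)
Definition entry_of (i : 'I_4) : 'I_2 * 'I_2 := (inord (i %/ 2), inord (i %% 2)).

Definition Xv (i : 'I_4) : mpoly.mpoly 4 Cx := mpoly.mpolyX Cx (mpoly.mnm1 i).

Definition det_poly : mpoly.mpoly 4 Cx :=
  Xv (inord 0) * Xv (inord 3) - Xv (inord 1) * Xv (inord 2).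

Definition det_divides (f : mpoly.mpoly 4 Cx) : Prop :=
  exists g : mpoly.mpoly 4 Cx, f = det_poly * g.

Definition homog_deg (k : nat) (f : mpoly.mpoly 4 Cx) : bool :=
  all (fun m => mpoly.mdeg m == k) (mpoly.msupp f).

Definition Keval (f : mpoly.mpoly 4 Cx) (A : 'M[K]_2) : K :=
  \big[Kadd/K0]_(m <- mpoly.msupp f)
     Kmul (Kconst (mpoly.mcoeff m f))
          (\big[Kmul/K1]_(i < 4) Kpow (A (entry_of i).1 (entry_of i).2) (m i)).

(** * The surface S_d.  With n = d/2 (floor) and e = d mod 2, so d = 2n+e,
    F(A) = sum_{j=0}^n t^{-j(j+1)} (det A)^(n-j) f_j(A), where f_j
    (written f_{2j+e} in the paper) is homogeneous of degree 2j+e. *)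
Definition surfF (d : nat) (f : 'I_(d./2).+1 -> mpoly.mpoly 4 Cx) (A : 'M[K]_2) : K :=
  \big[Kadd/K0]_(j < (d./2).+1)
     Kmul (Kt (- ((j * j.+1)%N)%:R))
          (Kmul (Kpow (Kdet A) (d./2 - j)) (Keval (f j) A)).

Definition in_surface (d : nat) (f : 'I_(d./2).+1 -> mpoly.mpoly 4 Cx)
  (A : 'M[K]_2) : Prop :=
  Kmx_puiseux A /\ Kmx_nz A /\ surfF f A = K0.

Definition is_Kline (A B : 'M[K]_2) : Prop :=
  Kmx_puiseux A /\ Kmx_puiseux B /\
  forall l m : K, is_puiseux l -> is_puiseux m ->
    Kmxadd (Kscale l A) (Kscale m B) = \matrix_(i, j) K0 ->
    l = K0 /\ m = K0.

Definition line_point (A B C : 'M[K]_2) : Prop :=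
  exists l m : K, is_puiseux l /\ is_puiseux m /\ (l <> K0 \/ m <> K0) /\
    C = Kmxadd (Kscale l A) (Kscale m B).

Definition lead_exp (A : 'M[K]_2) : rat :=
  ClassicalEpsilon.epsilon (inhabits 0)
    (fun alpha => (exists i j, A i j alpha <> 0) /\
                  forall i j (q : rat), alpha < q -> A i j q = 0).

Definition lead_mx (A : 'M[K]_2) : 'M[Cx]_2 := \matrix_(i, j) A i j (lead_exp A).

Definition mxc (B : 'M[Cx]_2) : 'M[Cx]_2 :=
  \matrix_(i, j)
    (if i == i0 then (if j == i0 then B i1 i1 else - B i0 i1)
                else (if j == i0 then - B i1 i0 else B i0 i0)).

Definition mx_star (B : 'M[Cx]_2) : 'M[Cx]_2 := (map_mx Num.conj B)^T.

Definition cexp (x : rat) : Cx := Complex (Rtrigo_def.exp (ratr x)) 0.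

Definition det1_scale (A : 'M[K]_2) : K :=
  ClassicalEpsilon.epsilon (inhabits K0)
    (fun s => is_puiseux s /\ Kdet (Kscale s A) = K1).

Definition VALrep (A : 'M[K]_2) : 'M[Cx]_2 :=
  if pselect (Kdet A = K0) then lead_mx A
  else
    let A' := Kscale (det1_scale A) A in
    let alpha := lead_exp A' in
    let B := lead_mx A' in
    cexp alpha *: B + cexp (- alpha) *: mx_star (mxc B).

Definition proj_eq (M N : 'M[Cx]_2) : Prop := exists c : Cx, c != 0 /\ M = c *: N.

Definition VAL_sub (X Y : 'M[K]_2 -> Prop) : Prop :=
  forall C, X C -> exists D, Y D /\ proj_eq (VALrep C) (VALrep D).

(** * Genericity.  Coordinates on the space of coefficient tuples
    (f_j)_{j<=n}, f_j homogeneous of degree 2j+e: pairs (j, m), m a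
    monomial in 4 variables of degree 2j+e. *)
Definition coef_idx (d : nat) : finType :=
  {x : 'I_(d./2).+1 * mpoly.bmultinom 4 d.+1 |
     mpoly.mdeg (x.2 : mpoly.multinom 4) == (2 * x.1 + odd d)%N}.

Definition coef_vec (d : nat) (f : 'I_(d./2).+1 -> mpoly.mpoly 4 Cx)
  (k : 'I_#|coef_idx d|) : Cx :=
  let x := val (enum_val k) in mpoly.mcoeff (x.2 : mpoly.multinom 4) (f x.1).

(* Main.v *)
(* On a point of K P^3 with leading matrix [M] and determinant of leading term [e t^de],
   VAL records the level [al = ga - de / 2], where [ga] is the leading exponent of the
   matrix, and [M / sqrt e] up to a real factor (for [det = 0], [al] is infinite). If
   [j < al < j + 1] (or [j = n < al]), the [j]-th term alone dominates the equation of
   the surface, so [f_j] vanishes at [M]; if [al = j], then [f_j(M) = - rho e f_(j-1)(M)]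
   for some [rho > 0].

   A line [L] has a basis [A0, A1] with [det A0 = 0] and linearly independent
   reductions [B0, B1], so that [det (x A0 + y A1) = y (b x + c y)]; let [al0] be minus
   half the leading exponent of [(b, c)]. If [al0 < 1], points of [L] reducing to [B0]
   occur at all levels above [al0], and [f_0, f_1, f_n] vanish at [B0]. If [al0 >= 1],
   the line through [B0, B1] lies on the quadric [det = 0]. On it some [f_j], [j > 0],
   vanishes identically when [al0] is infinite, not an integer, or greater than [n];
   otherwise, for [j = al0], the ratio of [f_j] to [q f_(j-1)], with [q] the reduction
   of [y (b x + c y)], is real wherever defined, hence constant. When [j = 1] the roots
   of [q] come from points of [L] with [det = 0], so that [f_n] vanishes there as well.

   Each of these events has codimension at least 2 on a given line of the quadric, and
   the lines form one-parameter families. The coefficient vectors to be avoided are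
   therefore values of polynomial maps from spaces of smaller dimension, and a nonzero
   polynomial vanishing on such values exists by linear algebra. *)
Require Import Defs.
From HB Require Import structures.
From mathcomp Require Import all_boot all_order all_algebra.
From mathcomp Require Import boolp classical_sets fsbigop.
From mathcomp Require Import complex.
From mathcomp Require Import mpoly.
From mathcomp Require Import ring lra zify.
From mathcomp Require Import Rstruct.
From Stdlib Require Rtrigo_def Exp_prop Rpower ClassicalEpsilon.
Import Order.TTheory GRing.Theory Num.Theory.
Local Open Scope ring_scope.

Set Implicit Arguments.
Unset Strict Implicit.
Unset Printing Implicit Defensive.

(* Otherwise [/=] unfolds the structure of [Cx] and canonical inference gets lost. *)
Opaque Cx.

(** * Images of polynomial maps *)

(** The count behind [image_thin], with [s = E ^ n]: the left side is at most
    [((s + 1) * E) ^ n = (s + 1) ^ n * s]. *)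
Lemma pow_count (E n : nat) : (0 < E)%N ->
  (((E ^ n) * E).+1 ^ n < (E ^ n).+1 ^ n.+1)%N.
Proof.
move=> E0; set s := (E ^ n)%N.
apply: (@leq_ltn_trans ((s.+1 * E) ^ n)).
  have h : ((s * E).+1 <= s.+1 * E)%N by rewrite mulSn -add1n leq_add2r.
  by move: s h => s h; case: n => // n; rewrite leq_exp2r.
by rewrite expnMn expnSr ltn_pmul2l ?expn_gt0 //.
Qed.

Lemma msize_prod_exp (R : idomainType) (N M s : nat) (F : 'I_N -> {mpoly R[N]})
    (a : 'I_N -> nat) : (forall i, (msize (F i) <= M.+1)%N) -> (forall i, (a i <= s)%N) ->
  (msize (\prod_i F i ^+ a i) <= (s * (N * M)).+1)%N.
Proof.
move=> hF ha.
have aux (p : {mpoly R[N]}) k : (msize p <= M.+1)%N -> (msize (p ^+ k) <= (k * M).+1)%N.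
  move=> hp; elim: k => [|k IH]; first by rewrite expr0 msize1.
  rewrite exprS; have [->|p0] := eqVneq p 0; first by rewrite mul0r msize0.
  have [->|q0] := eqVneq (p ^+ k) 0; first by rewrite mulr0 msize0.
  by rewrite msizeM //; move: hp IH; rewrite mulSn; lia.
have -> : (s * (N * M) = \sum_(i < N) s * M)%N by rewrite sum_nat_const card_ord; lia.
elim/big_rec2: _ => [|i k p _ IH]; first by rewrite msize1.
have h := aux _ (a i) (hF i).
have [->|p0] := eqVneq (F i ^+ a i) 0; first by rewrite mul0r msize0.
have [->|q0] := eqVneq p 0; first by rewrite mulr0 msize0.
rewrite msizeM //; have : (a i * M <= s * M)%N by rewrite leq_mul2r ha orbT.
by move: h IH; lia.
Qed.

(* Linear algebra: on the hyperplane [y p = 0] the products [\prod_i F i ^+ a i]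
   with exponents at most [s] span a space of dimension [O(s ^ (N - 1))],
   whereas there are [(s + 1) ^ N] of them. *)
Lemma image_thin (R : fieldType) (N : nat) (F : 'I_N -> {mpoly R[N]}) (p : 'I_N) :
  exists P : {mpoly R[N]}, P != 0 /\
    forall y : 'I_N -> R, y p = 0 -> P.@[fun i => (F i).@[y]] = 0.
Proof.
case: N F p => [|n] F p; first by case: p.
(* With exponents at most [s], the products have degree at most [s * E]; the value of [s] is the one
   required by [pow_count]. *)
pose M := (\max_i msize (F i))%N; pose E := (n.+1 * M).+1; pose s := (E ^ n)%N.
have hF i : (msize (F i) <= M.+1)%N.
  exact: leqW (leq_bigmax i).
pose A := {ffun 'I_n.+1 -> 'I_s.+1}; pose B := {ffun 'I_n -> 'I_(s * E).+1}.
pose ma (a : A) : 'X_{1..n.+1} := [multinom (a i : nat) | i < n.+1].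
(* Monomials free of the variable [p], the only ones that survive on the hyperplane. *)
pose mb (b : B) : 'X_{1..n.+1} :=
  [multinom (if unlift p i is Some j then b j : nat else 0%N) | i < n.+1].
pose G (a : A) := \prod_i F i ^+ a i.
pose Mx : 'M[R]_(#|A|, #|B|) := \matrix_(i, j) (G (enum_val i))@_(mb (enum_val j)).
have ltc : (#|B| < #|A|)%N by rewrite !card_ffun !card_ord pow_count.
have : kermx Mx != 0.
  rewrite -mxrank_eq0 mxrank_ker subn_eq0 -ltnNge.
  exact: leq_ltn_trans (rank_leq_col _) ltc.
move=> /rowV0Pn[v /sub_kermxP vM v0].
pose c (a : A) := v 0 (enum_rank a).
exists (\sum_a c a *: 'X_[ma a]); split.
  apply: contra_neq v0 => P0; apply/rowP => k; rewrite mxE.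
  have := congr1 (fun q => q@_(ma (enum_val k))) P0.
  rewrite mcoeff0 raddf_sum /= (bigD1 (enum_val k)) //= big1 => [|a hak].
    by rewrite addr0 mcoeffZ mcoeffX eqxx mulr1 /c enum_valK.
  rewrite mcoeffZ mcoeffX; case: eqP => [/mnmP E0|]; last by rewrite mulr0.
  case/eqP: hak; apply/ffunP => i; apply: val_inj.
  by have := E0 i; rewrite !mnmE.
move=> y yp.
have -> : (\sum_a c a *: 'X_[ma a]).@[fun i => (F i).@[y]] = (\sum_a c a *: G a).@[y].
  rewrite !raddf_sum /=; apply: eq_bigr => a _; rewrite !mevalZ; congr (_ * _).
  rewrite mevalX rmorph_prod /=; apply: eq_bigr => i _.
  by rewrite rmorphXn /= mnmE.
set Q := \sum_a _.
have sQ : (msize Q <= (s * E).+1)%N.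
  apply: (leq_trans (msize_sum _ _ _)); apply/bigmax_leqP_seq => a _ _.
  apply: leq_trans (msizeZ_le _ _) _.
  apply: (@leq_trans (s * (n.+1 * M)).+1); last by rewrite ltnS leq_mul2l leqnSn orbT.
  by apply: msize_prod_exp => // i; rewrite -ltnS.
rewrite mevalE big_seq big1 // => m mQ.
(* A monomial involving the variable [p] vanishes at [y]; any other one labels a column of [Mx], and
   its coefficient in [Q] is an entry of [v *m Mx = 0]. *)
have [mp|mp] := eqVneq (m p) 0%N; last first.
  by rewrite (bigD1 p) //= yp expr0n (negPf mp) mul0r mulr0.
have mle i : (m i < (s * E).+1)%N.
  apply: leq_trans sQ; apply: leq_ltn_trans (msize_mdeg_lt mQ).
  by rewrite mdegE (bigD1 i) //= leq_addr.
pose b : B := [ffun j => Ordinal (mle (lift p j))].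
have -> : m = mb b.
  apply/mnmP => i; rewrite mnmE; case: unliftP => [j ->|->//].
  by rewrite ffunE.
suff -> : Q@_(mb b) = 0 by rewrite mul0r.
have := congr1 (fun w : 'rV_ _ => w 0 (enum_rank b)) vM; rewrite !mxE => <-.
rewrite raddf_sum /= (reindex_onto enum_val enum_rank) => [|a _]; last exact: enum_rankK.
apply: eq_big => [k|k _]; first by rewrite enum_valK eqxx.
by rewrite mcoeffZ mxE enum_rankK /c enum_valK.
Qed.

Section PolynomialMaps.
Variables (R : fieldType) (J : finType).

Definition jeval (P : {mpoly R[#|J|]}) (y : J -> R) : R := P.@[fun k => y (enum_val k)].

Definition polyfun (phi : (J -> R) -> R) := exists P, forall y, phi y = jeval P y.

(** Contained in a proper Zariski-closed subset; [S] itself need not be closed. *)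
Definition thin (S : (J -> R) -> Prop) :=
  exists P, P != 0 /\ forall y, S y -> jeval P y = 0.

Lemma polyfun_const c : polyfun (fun=> c).
Proof. by exists c%:MP => y; rewrite /jeval mevalC. Qed.

Lemma polyfun_var j : polyfun (fun y => y j).
Proof. by exists 'X_(enum_rank j) => y; rewrite /jeval mevalXU enum_rankK. Qed.

Lemma polyfunD phi psi : polyfun phi -> polyfun psi -> polyfun (fun y => phi y + psi y).
Proof. by move=> [P hP] [Q hQ]; exists (P + Q) => y; rewrite /jeval mevalD hP hQ. Qed.

Lemma polyfunM phi psi : polyfun phi -> polyfun psi -> polyfun (fun y => phi y * psi y).
Proof. by move=> [P hP] [Q hQ]; exists (P * Q) => y; rewrite /jeval mevalM hP hQ. Qed.

Lemma polyfunN phi : polyfun phi -> polyfun (fun y => - phi y).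
Proof. by move=> [P hP]; exists (- P) => y; rewrite /jeval mevalN hP. Qed.

Lemma polyfunX phi k : polyfun phi -> polyfun (fun y => phi y ^+ k).
Proof. by move=> [P hP]; exists (P ^+ k) => y; rewrite /jeval rmorphXn /= hP. Qed.

Lemma polyfun_sum (I : Type) (r : seq I) (Q : pred I) (phi : I -> (J -> R) -> R) :
  (forall i, Q i -> polyfun (phi i)) -> polyfun (fun y => \sum_(i <- r | Q i) phi i y).
Proof.
move=> h; elim: r => [|i r [P hP]].
  by have [P hP] := polyfun_const 0; exists P => y; rewrite big_nil -hP.
have [Qi|Qi] := boolP (Q i); last by exists P => y; rewrite big_cons (negPf Qi).
have [P' hP'] := h i Qi; exists (P' + P) => y.
by rewrite big_cons Qi hP hP' /jeval mevalD.
Qed.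

(** Source and target have the same coordinates and one source coordinate is frozen at 0, so the
    image loses a dimension. All dimension counts take this form. *)
Lemma thin_image (phi : J -> (J -> R) -> R) (p : J) : (forall j, polyfun (phi j)) ->
  thin (fun z => exists y, y p = 0 /\ forall j, z j = phi j y).
Proof.
move=> hphi; have /choice[F hF] : forall k : 'I_#|J|, exists P, forall y,
    phi (enum_val k) y = jeval P y by move=> k; apply: hphi.
have [P [P0 hP]] := image_thin F (enum_rank p).
exists P; split=> // z [y [yp hz]].
rewrite -[RHS](hP (fun k => y (enum_val k))) ?enum_rankK //.
by apply: mpoly.meval_eq => k; rewrite hz hF.
Qed.

Lemma thin_sub (S T : (J -> R) -> Prop) : (forall y, S y -> T y) -> thin T -> thin S.
Proof. by move=> h [P [P0 hP]]; exists P; split=> // y /h/hP. Qed.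

Lemma thin_union (I : finType) (S : I -> (J -> R) -> Prop) :
  (forall i, thin (S i)) -> thin (fun y => exists i, S i y).
Proof.
move=> /choice[P hP]; exists (\prod_i P i); split.
  by apply/prodf_neq0 => i _; case: (hP i).
move=> y [i Siy]; rewrite /jeval rmorph_prod /= (bigD1 i) //=.
by rewrite -/(jeval _ _) (hP i).2 ?mul0r.
Qed.

Lemma thinU (S T : (J -> R) -> Prop) :
  thin S -> thin T -> thin (fun y => S y \/ T y).
Proof.
move=> [P [P0 hP]] [Q [Q0 hQ]]; exists (P * Q); split; first by rewrite mulf_neq0.
move=> y [/hP|/hQ] h; rewrite /jeval mevalM -!/(jeval _ _) h ?mul0r ?mulr0 //.
Qed.

End PolynomialMaps.

(** * Polynomials restricted to the lines of the quadric [det = 0] *)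

Section Chart.
Variables (rc fl : bool).

(* Bihomogeneous coordinates of the quadric: with [rc] the matrix has rows
   [v] and [x v] (otherwise columns), in an order chosen by [fl]. *)
Definition chart (i : 'I_4) : bool * bool :=
  let r := (1 < i)%N in let c := odd i in
  if rc then (r (+) fl, c) else (c (+) fl, r).

Definition unchart (b : bool * bool) : 'I_4 :=
  let r := if rc then b.1 (+) fl else b.2 in
  let c := if rc then b.2 else b.1 (+) fl in inord (r.*2 + c).

Lemma chartK : cancel chart unchart.
Proof.
move=> i; apply: val_inj; rewrite /unchart /chart.
by case: i => [[|[|[|[|i]]]] hi] //=; case: rc; case: fl => /=; rewrite inordK.
Qed.

Lemma unchartK : cancel unchart chart.
Proof.
move=> [[] []]; rewrite /chart /unchart;
by case: rc; case: fl => /=; rewrite inordK.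
Qed.

Definition xdeg (m : 'X_{1..4}) : nat := (\sum_(i | (chart i).1) m i)%N.
Definition vdeg (m : 'X_{1..4}) : nat := (\sum_(i | (chart i).2) m i)%N.

Definition cpt (x v0 v1 : Cx) (i : 'I_4) : Cx :=
  (if (chart i).1 then x else 1) * (if (chart i).2 then v1 else v0).

Lemma vdeg_le m : (vdeg m <= mdeg m)%N.
Proof. by rewrite mdegE [X in (_ <= X)%N](bigID (fun i => (chart i).2)) leq_addr. Qed.

Lemma cpt_monomial x v0 v1 (m : 'X_{1..4}) :
  \prod_i cpt x v0 v1 i ^+ m i = x ^+ xdeg m * (v0 ^+ (mdeg m - vdeg m) * v1 ^+ vdeg m).
Proof.
rewrite /cpt; under eq_bigr do rewrite exprMn.
rewrite big_split /=; congr (_ * _).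
  rewrite (bigID (fun i => (chart i).1)) /= [X in _ * X]big1 => [|i /negPf->]; last exact: expr1n.
  by rewrite mulr1 /xdeg -prodrXr; apply: eq_bigr => i ->.
have -> : (mdeg m - vdeg m = \sum_(i | ~~ (chart i).2) m i)%N.
  by rewrite mdegE (bigID (fun i => (chart i).2)) /= addKn.
rewrite (bigID (fun i => (chart i).2)) /= mulrC /vdeg -!prodrXr.
by congr (_ * _); apply: eq_bigr => i; [move/negPf|] => ->.
Qed.

(** The only monomial of degree [k] that restricts to [v0 ^ (k - i) * v1 ^ i] without a power of
    [x]. *)
Definition purem (k i : nat) : 'X_{1..4} :=
  [multinom (if l == unchart (false, false) then k - i
             else if l == unchart (false, true) then i else 0)%N | l < 4].

Lemma unchart_eq b b' : (unchart b == unchart b') = (b == b').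
Proof. by rewrite (can_eq unchartK). Qed.

Lemma sum_chart (P : pred (bool * bool)) (F : 'I_4 -> nat) :
  (\sum_(i | P (chart i)) F i = \sum_(b | P b) F (unchart b))%N.
Proof.
rewrite (reindex unchart); last by exists chart => b _; rewrite ?unchartK ?chartK.
by apply: eq_bigl => b; rewrite unchartK.
Qed.

Lemma sum_bb (P : pred (bool * bool)) (F : bool * bool -> nat) :
  (\sum_(b | P b) F b = (if P (false, false) then F (false, false) else 0) +
   (if P (false, true) then F (false, true) else 0) +
   (if P (true, false) then F (true, false) else 0) +
   (if P (true, true) then F (true, true) else 0))%N.
Proof.
pose G a b := (if P (a, b) then F (a, b) else 0)%N.
rewrite big_mkcond (eq_bigr (fun p => G p.1 p.2)) => [|[a b] //].
by rewrite -(pair_bigA _ G) /= !big_bool /= /G; lia.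
Qed.

Lemma mdeg_chart m : mdeg m = (m (unchart (false, false)) + m (unchart (false, true))
  + m (unchart (true, false)) + m (unchart (true, true)))%N.
Proof. by rewrite mdegE (@sum_chart predT m) sum_bb. Qed.

Lemma xdeg_chart m : xdeg m = (m (unchart (true, false)) + m (unchart (true, true)))%N.
Proof. by rewrite /xdeg (@sum_chart (fun b => b.1) m) sum_bb. Qed.

Lemma vdeg_chart m : vdeg m = (m (unchart (false, true)) + m (unchart (true, true)))%N.
Proof. by rewrite /vdeg (@sum_chart (fun b => b.2) m) sum_bb /= addn0. Qed.

Lemma puremE k i : (i <= k)%N ->
  [/\ mdeg (purem k i) = k, xdeg (purem k i) = 0%N & vdeg (purem k i) = i].
Proof.
move=> hi; rewrite mdeg_chart xdeg_chart vdeg_chart !mnmE !unchart_eq /=.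
by split=> //; lia.
Qed.

Lemma purem_uniq m : xdeg m = 0%N -> m = purem (mdeg m) (vdeg m).
Proof.
rewrite mdeg_chart xdeg_chart vdeg_chart => h; apply/mnmP => l.
rewrite mnmE -[l]chartK !unchart_eq; case: (chart l) => [[] []] /=; lia.
Qed.

End Chart.

(** The binary form of degree [k] that becomes [h] at [v0 = 1]. The degree is explicit because [h]
    has smaller degree when the form vanishes at [v0 = 0]. *)
Definition hom (k : nat) (h : {poly Cx}) (v0 v1 : Cx) : Cx :=
  \sum_(i < k.+1) h`_i * (v0 ^+ (k - i) * v1 ^+ i).

Lemma homD k h1 h2 v0 v1 : hom k (h1 + h2) v0 v1 = hom k h1 v0 v1 + hom k h2 v0 v1.
Proof.
by rewrite /hom -big_split /=; apply: eq_bigr => i _; rewrite coefD mulrDl.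
Qed.

Lemma homZ k a h v0 v1 : hom k (a *: h) v0 v1 = a * hom k h v0 v1.
Proof. by rewrite /hom mulr_sumr; apply: eq_bigr => i _; rewrite coefZ mulrA. Qed.

Lemma hom0 k v0 v1 : hom k 0 v0 v1 = 0.
Proof. by rewrite /hom big1 // => i _; rewrite coef0 mul0r. Qed.

Lemma homXn k w v0 v1 : (w <= k)%N -> hom k 'X^w v0 v1 = v0 ^+ (k - w) * v1 ^+ w.
Proof.
move=> hw; have hw' : (w < k.+1)%N by [].
rewrite /hom (bigD1 (Ordinal hw')) //= coefXn eqxx mul1r big1 ?addr0 // => i hi.
by rewrite coefXn -val_eqE /= in hi *; rewrite (negPf hi) mul0r.
Qed.

Lemma hom_sum k (I : Type) (r : seq I) P (F : I -> {poly Cx}) v0 v1 :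
  hom k (\sum_(i <- r | P i) F i) v0 v1 = \sum_(i <- r | P i) hom k (F i) v0 v1.
Proof.
exact: (big_morph (fun h => hom k h v0 v1) (fun p q => homD k p q v0 v1) (hom0 k v0 v1)).
Qed.

Section Restriction.
Variable d : nat.
Notation n := (d./2).
Notation J := (coef_idx d).
Notation dg j := (2 * j + odd d)%N.

Definition jj (y : J) : 'I_n.+1 := (val y).1.
Definition jm (y : J) : 'X_{1..4} := (val y).2.

Lemma jm_deg y : mdeg (jm y) = dg (jj y).
Proof. exact: eqP (valP y). Qed.

Lemma dg_lt (j : 'I_n.+1) : (dg j < d.+1)%N.
Proof. by have := ltn_ord j; have := odd_double_half d; lia. Qed.

Lemma jidx_ex (j : 'I_n.+1) (m : 'X_{1..4}) : mdeg m = dg j ->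
  exists y : J, jj y = j /\ jm y = m.
Proof.
move=> hm; have hb : (mdeg m < d.+1)%N by rewrite hm dg_lt.
pose Q (x : 'I_n.+1 * bmultinom 4 d.+1) := mdeg (x.2 : 'X_{1..4}) == dg x.1.
have P : Q (j, BMultinom hb) by rewrite /Q hm.
by exists (exist Q (j, BMultinom hb) P).
Qed.

Lemma jidx_inj (y y' : J) : jj y = jj y' -> jm y = jm y' -> y = y'.
Proof.
case: y y' => [[j m] h] [[j' m'] h'] /= E1 E2; apply: val_inj => /=.
by move: E1 E2; rewrite /jj /jm /= => -> /val_inj->.
Qed.

Definition coefs (f : 'I_n.+1 -> {mpoly Cx[4]}) (y : J) : Cx := (f (jj y))@_(jm y).

(** Homogeneity confines the support of [f] to degree [dg j], so evaluation can be written in the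
    coordinates used for genericity. *)
Lemma sum_coef_idx (f : {mpoly Cx[4]}) (j : 'I_n.+1) (F : 'X_{1..4} -> Cx) :
  homog_deg (dg j) f ->
  \sum_(m <- msupp f) f@_m * F m = \sum_(y : J | jj y == j) f@_(jm y) * F (jm y).
Proof.
move=> /allP hf.
have E : \sum_(m <- msupp f) f@_m * F m =
   \sum_(m : 'X_{1..4 < d.+1}) f@_m * F m.
  rewrite (bigID (fun m : 'X_{1..4 < d.+1} => (m : 'X_{1..4}) \in msupp f)) /=.
  rewrite [X in _ = _ + X]big1 => [|m]; last by rewrite mcoeff_msupp negbK => /eqP->; rewrite mul0r.
  rewrite addr0 -(big_map (fun m : 'X_{1..4 < d.+1} => bmnm m) (mem (msupp f)) (fun m => f@_m * F m)).
  rewrite -[RHS]big_filter; apply: perm_big; apply: uniq_perm.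
  - exact: msupp_uniq.
  - by rewrite filter_uniq // map_inj_uniq ?index_enum_uniq //; exact: val_inj.
  move=> m; rewrite mem_filter /=; case: (boolP (m \in msupp f)) => hm; last by [].
  have hb : (mdeg m < d.+1)%N by rewrite (eqP (hf m hm)) dg_lt.
  symmetry; rewrite /=; apply/mapP; by exists (BMultinom hb); rewrite ?mem_index_enum.
rewrite E (bigID (fun m : 'X_{1..4 < d.+1} => mdeg m == dg j)) /=.
rewrite [X in _ + X]big1 ?addr0 => [|m hm]; last first.
  have [/hf|] := boolP ((m : 'X_{1..4}) \in msupp f); first by rewrite (negPf hm).
  by rewrite mcoeff_msupp negbK => /eqP->; rewrite mul0r.
pose F2 (x : 'I_n.+1 * bmultinom 4 d.+1) := f@_(x.2) * F x.2.
rewrite (reindex_omap (fun y : J => (val y).2)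
  (fun m => if insub (j, m) is Some y then if jj y == j then Some y else None else None)); last first.
  move=> m hm; case: insubP => [u _ uE|/=]; last by rewrite hm.
  by rewrite /jj uE /= eqxx /= uE.
apply: eq_bigl => y; apply/andP/eqP => [[_]|<-].
  by case: insubP => // u _ uE; case: ifP => // /eqP uj /eqP[<-].
split; first by rewrite -/(jm y) jm_deg.
rewrite -/(jj y) /jj -surjective_pairing valK /=.
by rewrite eqxx.
Qed.

Variables (rc fl : bool).
Notation xdeg := (xdeg rc fl).
Notation vdeg := (vdeg rc fl).

(** The [j]-th form with coefficients [z], restricted to the line of the ruling with parameter [x]
    and dehomogenized at [v0 = 1]. *)
Definition hz (z : J -> Cx) (x : Cx) (j : 'I_n.+1) : {poly Cx} :=
  \sum_(y : J | jj y == j) (z y * x ^+ xdeg (jm y)) *: 'X^(vdeg (jm y)).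

Lemma hz_eval f x v0 v1 (j : 'I_n.+1) : homog_deg (dg j) (f j) ->
  (f j).@[cpt rc fl x v0 v1] = hom (dg j) (hz (coefs f) x j) v0 v1.
Proof.
move=> hf; rewrite mevalE (sum_coef_idx (fun m => \prod_i _ i ^+ m i) hf) hom_sum.
apply: eq_bigr => y /eqP yj; rewrite homZ homXn; last by rewrite -yj -jm_deg vdeg_le.
by rewrite cpt_monomial jm_deg /coefs yj -!mulrA.
Qed.

Lemma size_hz z x j : (size (hz z x j) <= (dg j).+1)%N.
Proof.
apply: (leq_trans (size_sum _ _ _)); apply/bigmax_leqP => y /eqP yj.
rewrite (leq_trans (size_scale_leq _ _)) // size_polyXn ltnS -yj -jm_deg.
exact: vdeg_le.
Qed.

Lemma hz_coef z x j i : (hz z x j)`_i =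
  \sum_(y : J | (jj y == j) && (vdeg (jm y) == i)) z y * x ^+ xdeg (jm y).
Proof.
rewrite coef_sum (bigID (fun y => vdeg (jm y) == i)) /= [X in _ + X]big1 ?addr0.
  by apply: eq_bigr => y /andP[_ /eqP hy]; rewrite coefZ coefXn hy eqxx mulr1.
by move=> y /andP[_ /negPf hy]; rewrite coefZ coefXn eq_sym hy mulr0.
Qed.

(** The bound on [i] sits under the quantifier so that the choice [pidx] is total; out of range its
    value is arbitrary. *)
Lemma pure_idx (j : 'I_n.+1) (i : nat) : exists y : J,
  (i <= dg j)%N -> [/\ jj y = j, xdeg (jm y) = 0%N & vdeg (jm y) = i].
Proof.
have [hi|hi] := leqP i (dg j).
  have [h1 h2 h3] := puremE rc fl hi.
  by have [y [yj ym]] := jidx_ex h1; exists y; rewrite yj ym.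
have [h1 _ _] := puremE rc fl (leqnn (dg j)).
by have [y _] := jidx_ex h1; exists y.
Qed.

Definition pidx (j : 'I_n.+1) (i : nat) : J := sval (cid (pure_idx j i)).

Lemma pidxP (j : 'I_n.+1) (i : nat) : (i <= dg j)%N ->
  [/\ jj (pidx j i) = j, xdeg (jm (pidx j i)) = 0%N & vdeg (jm (pidx j i)) = i].
Proof. exact: (svalP (cid (pure_idx j i))). Qed.

Lemma pure_uniq y : xdeg (jm y) = 0%N -> y = pidx (jj y) (vdeg (jm y)).
Proof.
move=> hx; have le : (vdeg (jm y) <= dg (jj y))%N by rewrite -jm_deg vdeg_le.
have [h1 h2 h3] := pidxP le; apply: jidx_inj; rewrite ?h1 //.
by rewrite [LHS](purem_uniq hx) [RHS](purem_uniq h2) !jm_deg h1 h3.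
Qed.

Variables (j1 j2 : 'I_n.+1) (i1 i2 : nat) (sz : 'I_n.+1 -> nat).
Hypotheses (hi1 : (sz j1 <= i1 <= dg j1)%N) (hi2 : (sz j2 <= i2 <= dg j2)%N).
Hypothesis neq12 : (j1 != j2) || (i1 != i2).
Hypothesis sz_le : forall j, (sz j <= (dg j).+1)%N.

(** Decodes the free polynomials of a parametrization, stored in the slots of the monomials free of
    [x]. *)
Definition rd (w : J -> Cx) (j : 'I_n.+1) : {poly Cx} := \poly_(i < sz j) w (pidx j i).

(* The coefficients of the monomials free of [x] are replaced by those of the
   restricted polynomials, so that a condition on the latter becomes a
   polynomial parametrization. Of the two slots left unused, one stores the
   parameter [x] of the line and the other one witnesses the drop in dimension. *)
Lemma thin_chart (Psi : ('I_n.+1 -> {poly Cx}) -> 'I_n.+1 -> {poly Cx}) :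
  (forall j i, polyfun (fun w => (Psi (rd w) j)`_i)) ->
  thin (fun z => exists x (A : 'I_n.+1 -> {poly Cx}), (forall j, (size (A j) <= sz j)%N) /\
     forall j, hz z x j = Psi A j).
Proof.
move=> hPsi; set p1 := pidx j1 i1; set p2 := pidx j2 i2.
have [q11 q12 q13] := pidxP (proj2 (andP hi1)).
have [q21 q22 q23] := pidxP (proj2 (andP hi2)).
(* The formula [hz_coef] solved for the coefficient of the monomial free of [x], with [x] read from
   the slot [p1]. *)
pose phi (y : J) (w : J -> Cx) : Cx := if xdeg (jm y) == 0%N then
   (Psi (rd w) (jj y))`_(vdeg (jm y)) + - \sum_(y' : J | [&& jj y' == jj y,
     vdeg (jm y') == vdeg (jm y) & xdeg (jm y') != 0%N]) w y' * w p1 ^+ xdeg (jm y')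
  else w y.
have /(@thin_image _ _ _ p2) : forall y, polyfun (phi y).
  move=> y; rewrite /phi; case: (xdeg (jm y) == 0%N); last exact: polyfun_var.
  apply: polyfunD; first exact: hPsi.
  apply: polyfunN; apply: polyfun_sum => y' _.
  by apply: polyfunM; [exact: polyfun_var|apply: polyfunX; exact: polyfun_var].
apply: thin_sub => z [x [A [sA hA]]].
have np : p1 != p2.
  apply: contraL neq12 => /eqP E; rewrite negb_or !negbK -q11 -[j2]q21 -/p1 -/p2 E eqxx /=.
  by rewrite -q13 -[i2]q23 -/p1 -/p2 E eqxx.
pose w y := if y == p1 then x else if y == p2 then 0 else
  if xdeg (jm y) == 0%N then (A (jj y))`_(vdeg (jm y)) else z y.
have w1 : w p1 = x by rewrite /w eqxx.
have w2 : w p2 = 0 by rewrite /w eq_sym (negPf np) eqxx.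
have w3 y : xdeg (jm y) != 0%N -> w y = z y.
  move=> hy; rewrite /w (negPf hy); case: eqP => [E|_].
    by move: hy; rewrite E q12.
  by case: eqP => [E|_] //; move: hy; rewrite E q22.
(* The slots [p1] and [p2] lie at or beyond the sizes [sz], so decoding never reads them. *)
have rdE : rd w = A.
  apply: funext => j; apply/polyP => i; rewrite coef_poly; case: ltnP => hi; last first.
    by rewrite nth_default // (leq_trans (sA j)).
  have [e1 e2 e3] := pidxP (leq_trans hi (sz_le j)).
  rewrite /w e1 e2 e3 eqxx; case: eqP => [E|_].
    have Ej : j = j1 by rewrite -q11 -/p1 -E e1.
    have Ei : i = i1 by rewrite -q13 -/p1 -E e3.
    by move: hi hi1; rewrite Ei Ej => h /andP[]; rewrite leqNgt h.
  case: eqP => [E|//].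
  have Ej : j = j2 by rewrite -q21 -/p2 -E e1.
    have Ei : i = i2 by rewrite -q23 -/p2 -E e3.
    by move: hi hi2; rewrite Ei Ej => h /andP[]; rewrite leqNgt h.
exists w; split=> // y; rewrite /phi w1 rdE; case: ifPn => [/eqP hy|/w3//].
rewrite -hA hz_coef (bigD1 y) /= ?eqxx // hy expr0 mulr1.
(* Both sums run over the same indices: within one block and one [vdeg], only [y] is free of [x]. *)
set S1 := \sum_(_ | _) _; set S2 := \sum_(_ | _) _; suff -> : S1 = S2 by rewrite addrK.
rewrite /S1 /S2; apply: eq_big => [y'|y' /andP[/andP[y'j y'v] y'y]]; last first.
  rewrite w3 //; apply: contraNN y'y => /eqP hx; apply/eqP.
  by rewrite (pure_uniq hx) (eqP y'j) (eqP y'v) -pure_uniq.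
rewrite -andbA; case: eqP => //= y'j; case: eqP => //= y'v.
congr (~~ _); apply/idP/idP => /eqP => [->|hx]; first by rewrite hy.
by apply/eqP; rewrite (pure_uniq hx) y'j y'v -pure_uniq.
Qed.
End Restriction.

(** * Thinness of the exceptional sets of coefficient vectors *)

Definition ppolyfun (J : finType) (phi : (J -> Cx) -> {poly Cx}) :=
  forall i, polyfun (fun w => (phi w)`_i).

Lemma ppolyfunM (J : finType) (phi psi : (J -> Cx) -> {poly Cx}) :
  ppolyfun phi -> ppolyfun psi -> ppolyfun (fun w => phi w * psi w).
Proof.
move=> h1 h2 i; have [P hP] : polyfun (fun w : J -> Cx =>
    \sum_(j < i.+1) (phi w)`_j * (psi w)`_(i - j)).
  by apply: polyfun_sum => j _; apply: polyfunM; [apply: h1|apply: h2].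
by exists P => w; rewrite coefM hP.
Qed.

Section Generic.
Variables (d : nat) (rc fl : bool).
Hypothesis d3 : (3 < d)%N.
Notation n := (d./2).
Notation J := (coef_idx d).
Notation dg j := (2 * j + odd d)%N.
Notation hz := (@hz d rc fl).

Definition one : 'I_n.+1 := inord 1.

Lemma n_gt1 : (1 < n)%N.
Proof. by have := odd_double_half d; lia. Qed.

Lemma val_one : one = 1%N :> nat.
Proof. by rewrite inordK //; have := n_gt1; lia. Qed.

Lemma neq_one_max : (one == ord_max) = false.
Proof. by rewrite -val_eqE /= val_one; have := n_gt1; lia. Qed.

Lemma neq0_one : (ord0 == one :> 'I_n.+1) = false.
Proof. by rewrite -val_eqE /= val_one. Qed.

Lemma neq0_max : (ord0 == ord_max :> 'I_n.+1) = false.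
Proof. by rewrite -val_eqE /=; have := n_gt1; case: n. Qed.

Lemma ppolyfun_rd sz j : ppolyfun (fun w : J -> Cx => rd rc fl sz w j).
Proof.
move=> i; have [h|h] := ltnP i (sz j).
  have [P hP] := polyfun_var Cx (pidx rc fl j i).
  by exists P => w; rewrite coef_poly h hP.
have [P hP] := polyfun_const J (0 : Cx).
by exists P => w; rewrite coef_poly ltnNge h /= -hP.
Qed.

Lemma ppolyfun0 : ppolyfun (fun _ : J -> Cx => 0).
Proof.
move=> i; have [P hP] := polyfun_const J (0 : Cx).
by exists P => w; rewrite coef0 -hP.
Qed.

(** In positive degree at least two coefficients must vanish, against the single parameter [x];
    slots 0 and 1 of the block [j0] become free. *)
Lemma thin_zero (j0 : 'I_n.+1) : (0 < dg j0)%N -> thin (fun z => exists x, hz z x j0 = 0).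
Proof.
move=> h0; pose sz j := if j == j0 then 0%N else (dg j).+1.
pose Psi (A : 'I_n.+1 -> {poly Cx}) j := if j == j0 then 0 else A j.
have : thin (fun z => exists x (A : 'I_n.+1 -> {poly Cx}),
    (forall j, (size (A j) <= sz j)%N) /\ forall j, hz z x j = Psi A j).
  apply: (@thin_chart d rc fl j0 j0 0 1) => //; rewrite /sz ?eqxx //.
  - by move=> j; case: ifP.
  by rewrite /Psi => j; case: (j == j0); [exact: ppolyfun0|exact: ppolyfun_rd].
apply: thin_sub => z [x h]; exists x, (fun j => if j == j0 then 0 else hz z x j).
split=> j; rewrite ?/sz ?/Psi /=; have [E|_] := eqVneq j j0 => //; rewrite ?E //.
  by rewrite size_poly0.
exact: size_hz.
Qed.

(** The quotient [q] occupies slots 0 to 2 of the block [j0]. Since [j > 0], this block has degree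
    at least 4, so slots 3 and 4 are free. *)
Lemma thin_ratio (j j0 : 'I_n.+1) : j0 = j.+1 :> nat -> (0 < j)%N ->
  thin (fun z => exists x (q : {poly Cx}), (size q <= 3)%N /\ hz z x j0 = q * hz z x j).
Proof.
move=> hj0 hj; pose sz i := if i == j0 then 3%N else (dg i).+1.
pose Psi (A : 'I_n.+1 -> {poly Cx}) i := if i == j0 then A j0 * A j else A i.
have nj : (j == j0) = false by rewrite -val_eqE /= hj0; lia.
have : thin (fun z => exists x (A : 'I_n.+1 -> {poly Cx}),
    (forall j, (size (A j) <= sz j)%N) /\ forall j, hz z x j = Psi A j).
  apply: (@thin_chart d rc fl j0 j0 3 4) => //; rewrite /sz ?eqxx //; try lia.
  - by move=> i; have [->|_] := eqVneq i j0 => //; rewrite ?eqxx; lia.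
  rewrite /Psi => i; case: (i == j0); last exact: ppolyfun_rd.
  by apply: ppolyfunM; exact: ppolyfun_rd.
apply: thin_sub => z [x [q [sq h]]]; exists x, (fun i => if i == j0 then q else hz z x i).
split=> i; rewrite ?/sz ?/Psi ?eqxx ?nj; have [E|_] := eqVneq i j0 => //; rewrite ?E //.
exact: size_hz.
Qed.

(** Common pattern of the last three events of [bad]: the restrictions with indices 1 and [n] are
    computed from that of index 0 and from two free polynomials, stored in their own blocks. *)
Lemma thin_ends (F1 : {poly Cx} -> {poly Cx} -> {poly Cx})
   (Fn : {poly Cx} -> {poly Cx} -> {poly Cx} -> {poly Cx})
   (s1 sn : nat) (j1 j2 : 'I_n.+1) (i1 i2 : nat) :
  (forall phi psi : (J -> Cx) -> {poly Cx}, ppolyfun phi -> ppolyfun psi ->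
     ppolyfun (fun w => F1 (phi w) (psi w))) ->
  (forall phi psi chi : (J -> Cx) -> {poly Cx}, ppolyfun phi -> ppolyfun psi ->
     ppolyfun chi -> ppolyfun (fun w => Fn (phi w) (psi w) (chi w))) ->
  let sz j := if j == one then s1 else if j == ord_max then sn else (dg j).+1 in
  (sz j1 <= i1 <= dg j1)%N -> (sz j2 <= i2 <= dg j2)%N -> (j1 != j2) || (i1 != i2) ->
  (s1 <= (dg one).+1)%N -> (sn <= (dg n).+1)%N ->
  thin (fun z => exists x (A1 An : {poly Cx}), [/\ (size A1 <= s1)%N, (size An <= sn)%N,
    hz z x one = F1 (hz z x ord0) A1 & hz z x ord_max = Fn (hz z x ord0) A1 An]).
Proof.
move=> hF1 hFn sz h1 h2 h12 hs1 hsn.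
pose Psi (A : 'I_n.+1 -> {poly Cx}) j := if j == one then F1 (A ord0) (A one)
  else if j == ord_max then Fn (A ord0) (A one) (A ord_max) else A j.
have : thin (fun z => exists x (A : 'I_n.+1 -> {poly Cx}),
    (forall j, (size (A j) <= sz j)%N) /\ forall j, hz z x j = Psi A j).
  apply: (@thin_chart d rc fl j1 j2 i1 i2) => //.
  - by rewrite /sz => j; have [->|_] := eqVneq j one => //; have [->|_] := eqVneq j ord_max.
  rewrite /Psi => j; case: (j == one); first by apply: hF1; exact: ppolyfun_rd.
  by case: (j == ord_max); [apply: hFn|]; exact: ppolyfun_rd.
apply: thin_sub => z [x [A1 [An [sA1 sAn e1 en]]]].
exists x, (fun j => if j == one then A1 else if j == ord_max then An else hz z x j).
split=> j; rewrite ?/sz ?/Psi ?eqxx ?neq0_one ?neq0_max ?(eq_sym ord_max) ?neq_one_max.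
  have [//|_] := eqVneq j one; have [//|_] := eqVneq j ord_max; exact: size_hz.
have [->|_] := eqVneq j one; rewrite ?eqxx //.
by have [->|_] := eqVneq j ord_max; rewrite ?eqxx.
Qed.

(** On some line of the ruling: a form of positive degree vanishes; a form with index above 1 is the
    previous one times a quadratic [q]; the same for index 1, with [q] dividing the last form; the
    same with [q = l * l] and only [l] dividing the last form; the form of index 0 divides those of
    indices 1 and [n]. The size bounds are what makes each event thin. *)
Definition bad (z : J -> Cx) : Prop :=
  (exists j0 : 'I_n.+1, (0 < dg j0)%N /\ exists x, hz z x j0 = 0) \/
  (exists p : 'I_n.+1 * 'I_n.+1, (p.2 = p.1.+1 :> nat /\ (0 < p.1)%N) /\
     exists x (q : {poly Cx}), (size q <= 3)%N /\ hz z x p.2 = q * hz z x p.1) \/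
  (exists x (q r : {poly Cx}), [/\ (size q <= 3)%N, (size r <= (dg n).-1)%N,
     hz z x one = hz z x ord0 * q & hz z x ord_max = q * r]) \/
  (exists x (l r : {poly Cx}), [/\ (size l <= 2)%N, (size r <= dg n)%N,
     hz z x one = hz z x ord0 * (l * l) & hz z x ord_max = l * r]) \/
  (exists x (q r : {poly Cx}), [/\ (size q <= dg one)%N, (size r <= dg n)%N,
     hz z x one = hz z x ord0 * q & hz z x ord_max = hz z x ord0 * r]).

(** A side condition independent of [z] that fails leaves the empty set, on which the polynomial 1
    vanishes vacuously. *)
Lemma thin_guard (R : fieldType) (K : finType) (Q : (K -> R) -> Prop) (b : Prop) :
  (b -> thin Q) -> thin (fun z => b /\ Q z).
Proof.
move=> h; have [hb|nb] := pselect b.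
  by have [P [P0 hP]] := h hb; exists P; split=> // y [_ /hP].
by exists 1; split=> [|y []//]; rewrite oner_neq0.
Qed.

Lemma thin_bad : thin bad.
Proof.
have n1 := n_gt1; have v1 := val_one.
apply: thinU; first by apply: thin_union => j0; apply: thin_guard; exact: thin_zero.
apply: thinU.
  by apply: thin_union => -[j j0]; apply: thin_guard => -[]; exact: thin_ratio.
apply: thinU.
  (* Here [r] has two coefficients fewer than the last form, which frees the two top slots of its
     block. *)
  apply: (@thin_ends (fun a b => a * b) (fun a b c => b * c) 3 (dg n).-1 ord_max ord_max
     (dg n).-1 (dg n)); rewrite ?(eq_sym ord_max) ?neq_one_max ?eqxx //=; try lia.
  - by move=> *; apply: ppolyfunM.
  - by move=> *; apply: ppolyfunM.
apply: thinU.
  (* The linear [l] leaves slot 2 of the block of index 1 free, and [r] leaves the top slot of the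
     last block free. *)
  apply: (@thin_ends (fun a b => a * (b * b)) (fun a b c => b * c) 2 (dg n) one ord_max
     2 (dg n)); rewrite ?(eq_sym ord_max) ?neq_one_max ?eqxx //=; try lia.
  - by move=> *; do 2?[apply: ppolyfunM => //].
  - by move=> *; apply: ppolyfunM.
(* Each of the two quotients leaves the top slot of its block free. *)
apply: (@thin_ends (fun a b => a * b) (fun a b c => a * c) (dg one) (dg n) one ord_max
   (dg one) (dg n)); rewrite ?(eq_sym ord_max) ?neq_one_max ?eqxx //=; try lia.
- by move=> *; apply: ppolyfunM.
- by move=> *; apply: ppolyfunM.
Qed.

End Generic.

Lemma genericity (d : nat) : (3 < d)%N -> exists P : {mpoly Cx[#|coef_idx d|]}, P != 0 /\
  forall f : 'I_(d./2).+1 -> {mpoly Cx[4]}, P.@[coef_vec f] != 0 ->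
  forall rc fl, ~ bad rc fl (coefs f).
Proof.
move=> d3.
have [P [P0 hP]] : thin (fun z : coef_idx d -> Cx => exists b : bool * bool, bad b.1 b.2 z).
  by apply: thin_union => b; apply: thin_bad.
exists P; split=> // f /eqP Pf rc fl hb; apply: Pf; apply: (hP (coefs f)).
by exists (rc, fl).
Qed.

(** * Leading terms of series *)

Lemma Kext (a b : K) : a =1 b -> a = b.
Proof. by move=> h; apply: funext. Qed.

Lemma Kmul_seq (a b : K) (q : rat) (r : seq rat) : uniq r ->
  (forall p, p \notin r -> a p * b (q - p) = 0) ->
  Kmul a b q = \sum_(p <- r) a p * b (q - p).
Proof.
move=> ur h; rewrite /Kmul.
rewrite (fsbigE r) //; last by move=> p _ /h.
by apply: eq_bigl => p; rewrite in_setT.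
Qed.

(** The coefficient [c] may be 0: exponents are bounded by [e] and the coefficient there is
    recorded. Cancellation in sums and the zero series then need no separate treatment. *)
Definition led (a : K) (e : rat) (c : Cx) : Prop :=
  (forall q, e < q -> a q = 0) /\ a e = c.

Lemma led_mul a b e1 e2 c1 c2 : led a e1 c1 -> led b e2 c2 ->
  led (Kmul a b) (e1 + e2) (c1 * c2).
Proof.
move=> [a0 a1] [b0 b1]; split=> [q hq|].
  rewrite (@Kmul_seq _ _ _ [::]) ?big_nil // => p _.
  have [/a0->|hp] := ltP e1 p; first by rewrite mul0r.
  by rewrite b0 ?mulr0 //; lra.
rewrite (@Kmul_seq _ _ _ [:: e1]) // ?big_seq1 ?a1 ?(addrC e1) ?addrK ?b1 //.
move=> p; rewrite inE; case: ltgtP => // hp _; last by rewrite a0 ?mul0r.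
by rewrite b0 ?mulr0 //; lra.
Qed.

Lemma led_add a b e c1 c2 : led a e c1 -> led b e c2 -> led (Kadd a b) e (c1 + c2).
Proof.
move=> [a0 a1] [b0 b1]; split=> [q hq|]; last by rewrite /Kadd a1 b1.
by rewrite /Kadd a0 // b0 // addr0.
Qed.

Lemma led_opp a e c : led a e c -> led (Kopp a) e (- c).
Proof. by move=> [a0 a1]; split=> [q hq|]; rewrite /Kopp ?a1 // a0 ?oppr0. Qed.

Lemma led_weak a e e' c : led a e c -> e < e' -> led a e' 0.
Proof.
by move=> [a0 a1] h; split=> [q hq|]; apply: a0 => //; apply: lt_trans hq.
Qed.

Lemma led_const c : led (Kconst c) 0 c.
Proof. by rewrite /Kconst; split=> [q|]; rewrite ?eqxx //; case: ltgtP. Qed.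

Lemma led_Kt e : led (Kt e) e 1.
Proof. by rewrite /Kt; split=> [q|]; rewrite ?eqxx //; case: ltgtP. Qed.

Lemma led0 e : led K0 e 0.
Proof. by []. Qed.

Lemma led_uniq a e c c' : led a e c -> led a e c' -> c = c'.
Proof. by move=> [_ <-] []. Qed.

Lemma led_nz_uniq a e e' c c' : led a e c -> led a e' c' -> c != 0 -> c' != 0 ->
  e = e' /\ c = c'.
Proof.
move=> [h1 h2] [h3 h4] n0 n1.
have E : e = e'.
  have [h|h|//] := ltgtP e e'.
    by move: n1; rewrite -h4 h1 ?eqxx.
  by move: n0; rewrite -h2 h3 ?eqxx.
by rewrite -h2 -h4 E.
Qed.

Lemma led_exp a e c k : led a e c -> led (Kpow a k) (e *+ k) (c ^+ k).
Proof.
move=> h; elim: k => [|k IH]; first by rewrite mulr0n expr0; exact: led_const.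
by rewrite mulrS exprS; apply: led_mul.
Qed.

Lemma led_prod (I : Type) (r : seq I) (F : I -> K) (e : I -> rat) (c : I -> Cx) :
  (forall i, led (F i) (e i) (c i)) ->
  led (\big[Kmul/K1]_(i <- r) F i) (\sum_(i <- r) e i) (\prod_(i <- r) c i).
Proof.
move=> h; elim: r => [|i r IH]; first by rewrite !big_nil; exact: led_const.
by rewrite !big_cons; apply: led_mul.
Qed.

(** * The field of Puiseux series *)

(** Such a series is [t ^ M] times a power series in [t ^ (-1/N)], so it is determined by the
    sequence [crd N M a]. *)
Definition psupp (N M : nat) (a : K) :=
  forall q, a q != 0 -> exists k : nat, q = M%:R - k%:R / N%:R.

Lemma natr_neq0 (N : nat) : (0 < N)%N -> (N%:R : rat) != 0.
Proof. by rewrite pnatr_eq0 -lt0n. Qed.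

Lemma psupp_puiseux N M a : (0 < N)%N -> psupp N M a -> is_puiseux a.
Proof.
move=> N0 h; split.
  exists N; split=> // q /h[k ->]; exists (M%:Z * N%:Z - k%:Z).
  have := natr_neq0 N0 => N0'.
  rewrite rmorphB rmorphM /= !pmulrn; field; exact: N0'.
exists M%:R => q /h[k ->]; rewrite lerBlDr lerDl.
by rewrite divr_ge0 ?ler0n.
Qed.

Lemma psuppW N M N' M' a : (0 < N')%N -> (0 < N)%N -> (M <= M')%N ->
  psupp N M a -> psupp (N * N') M' a.
Proof.
move=> N0' N0 leM h q /h[k ->].
exists ((M' - M) * (N * N') + k * N')%N.
have n0 := natr_neq0 N0; have n0' := natr_neq0 N0'.
rewrite natrD !natrM natrB //; field; by rewrite n0 n0'.
Qed.

Lemma puiseux_psupp a : is_puiseux a -> exists N M, (0 < N)%N /\ psupp N M a.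
Proof.
move=> [[N [N0 hN]] [M hM]]; exists N, (Num.bound `|M|); split=> // q aq.
have n0 := natr_neq0 N0.
have [k qE] := hN q aq; have le1 := hM q aq.
have ltM : M < (Num.bound `|M|)%:R.
  exact: le_lt_trans (ler_norm M) (archi_boundP (normr_ge0 M)).
have le2 : k <= (Num.bound `|M| * N)%N%:Z.
  have : (k%:~R : rat) <= (Num.bound `|M| * N)%N%:R.
    rewrite natrM -ler_pdivrMr ?ltr0n // -qE; exact: ltW (le_lt_trans le1 ltM).
  by rewrite pmulrn ler_int.
exists `|(Num.bound `|M| * N)%N%:Z - k|%N.
rewrite natr_absz [`|_ - k|]ger0_norm ?subr_ge0 // intrB -pmulrn natrM qE; field; exact: n0.
Qed.

Lemma puiseux_common (a b c : K) : is_puiseux a -> is_puiseux b -> is_puiseux c ->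
  exists N M, (0 < N)%N /\ [/\ psupp N M a, psupp N M b & psupp N M c].
Proof.
move=> /puiseux_psupp[Na [Ma [Na0 ha]]] /puiseux_psupp[Nb [Mb [Nb0 hb]]].
move=> /puiseux_psupp[Nc [Mc [Nc0 hc]]].
exists (Na * (Nb * Nc))%N, (Ma + Mb + Mc)%N; split; first by rewrite !muln_gt0 Na0 Nb0.
split.
- by apply: psuppW ha; rewrite ?muln_gt0 ?Nb0 //; lia.
- rewrite mulnCA; apply: psuppW hb; rewrite ?muln_gt0 ?Na0 //; lia.
- rewrite mulnA mulnC; apply: psuppW hc; rewrite ?muln_gt0 ?Na0 //; lia.
Qed.

Definition crd (N M : nat) (a : K) (k : nat) : Cx := a (M%:R - k%:R / N%:R).

Lemma crdD N M a b k : crd N M (Kadd a b) k = crd N M a k + crd N M b k.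
Proof. by []. Qed.

(** Truncation turns the ring laws of series into those of polynomials, one degree at a time. *)
Definition trp (n : nat) (u : nat -> Cx) : {poly Cx} := \poly_(i < n.+1) u i.

Lemma coef_trp n u i : (i <= n)%N -> (trp n u)`_i = u i.
Proof. by move=> h; rewrite coef_poly ltnS h. Qed.

Lemma coefM_eqlow (p p' q q' : {poly Cx}) n :
  (forall i, (i <= n)%N -> p`_i = p'`_i) ->
  (forall i, (i <= n)%N -> q`_i = q'`_i) ->
  forall i, (i <= n)%N -> (p * q)`_i = (p' * q')`_i.
Proof.
move=> hp hq i hi; rewrite !coefM; apply: eq_bigr => j _.
by rewrite hp ?hq //; have := ltn_ord j; lia.
Qed.

Lemma psupp_ext N M a b : psupp N M a -> psupp N M b -> crd N M a =1 crd N M b -> a = b.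
Proof.
move=> ha hb h; apply: Kext => q.
have [aq|/ha[k ->]] := eqVneq (a q) 0; last exact: h.
have [bq|/hb[k ->]] := eqVneq (b q) 0; last exact: h.
by rewrite aq bq.
Qed.

Lemma Kmul_crd N M M' a b : (0 < N)%N -> psupp N M a -> psupp N M' b ->
  psupp N (M + M') (Kmul a b) /\
  forall n k, (k <= n)%N -> crd N (M + M') (Kmul a b) k =
    (trp n (crd N M a) * trp n (crd N M' b))`_k.
Proof.
move=> N0 ha hb; have n0 := natr_neq0 N0; split.
  move=> q; apply: contraPP => hq; apply/negP; rewrite negbK; apply/eqP.
  rewrite (@Kmul_seq _ _ _ [::]) ?big_nil // => p _.
  have [->|/ha[i pE]] := eqVneq (a p) 0; first by rewrite mul0r.
  have [->|/hb[j qE]] := eqVneq (b (q - p)) 0; first by rewrite mulr0.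
  case: hq; exists (i + j)%N; have -> : q = p + (q - p) by ring.
  by rewrite qE pE !natrD; field.
move=> n k hk; rewrite coefM -(big_mkord xpredT
  (fun i => (trp n (crd N M a))`_i * (trp n (crd N M' b))`_(k - i))).
rewrite /index_iota subn0 {1}/crd.
(* A contributing exponent of [a] is [M - i / N], and its partner in [b] is [M' - j / N] with
   [i + j = k]; hence [i <= k]. *)
rewrite (@Kmul_seq _ _ _ [seq (M%:R - i%:R / N%:R) | i <- iota 0 k.+1]); last 2 first.
- rewrite map_inj_uniq ?iota_uniq // => i j.
  by move/addrI/oppr_inj/(mulIf (invr_neq0 n0))/eqP; rewrite eqr_nat => /eqP.
- move=> p hp.
  have [->|/ha[i pE]] := eqVneq (a p) 0; first by rewrite mul0r.
  have [->|/hb[j qE]] := eqVneq (b ((M + M')%:R - k%:R / N%:R - p)) 0; first by rewrite mulr0.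
  case/negP: hp; rewrite pE; apply: (@map_f _ _ (fun i : nat => M%:R - i%:R / N%:R : rat)); rewrite mem_iota add0n /= ltnS.
  have E : k%:R / N%:R = (i + j)%:R / N%:R :> rat.
    by move: qE; rewrite pE !natrD mulrDl => qE; lra.
  have := mulIf (invr_neq0 n0) E.
  by move/eqP; rewrite eqr_nat => /eqP->; rewrite leq_addr.
rewrite big_map; apply: eq_big_seq => i; rewrite mem_iota add0n /= ltnS => hi.
rewrite !coef_trp; try lia.
rewrite /crd; congr (_ * b _); rewrite natrB // natrD; field; exact: n0.
Qed.

Lemma Kmul_puiseux a b : is_puiseux a -> is_puiseux b -> is_puiseux (Kmul a b).
Proof.
move=> ha hb; have [N [M [N0 [sa sb _]]]] := puiseux_common ha hb hb.
exact: psupp_puiseux (Kmul_crd N0 sa sb).1.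
Qed.

Lemma Kadd_psupp N M a b : psupp N M a -> psupp N M b -> psupp N M (Kadd a b).
Proof.
move=> ha hb q; rewrite /Kadd.
have [-> |/ha//] := eqVneq (a q) 0.
by have [-> |/hb//] := eqVneq (b q) 0; rewrite addr0 eqxx.
Qed.

Lemma Kadd_puiseux a b : is_puiseux a -> is_puiseux b -> is_puiseux (Kadd a b).
Proof.
move=> ha hb; have [N [M [N0 [sa sb _]]]] := puiseux_common ha hb hb.
exact: psupp_puiseux (Kadd_psupp sa sb).
Qed.

Lemma Kopp_puiseux a : is_puiseux a -> is_puiseux (Kopp a).
Proof.
move=> [[N [N0 h]] [M hM]]; split; [exists N; split=> //|exists M] => q;
 rewrite /Kopp oppr_eq0; auto.
Qed.

Lemma K0_puiseux : is_puiseux K0.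
Proof. by split; [exists 1%N|exists 0]; do ?split=> // q; rewrite /K0 eqxx. Qed.

Lemma Kt_puiseux e : is_puiseux (Kt e).
Proof.
rewrite /Kt; split; last by exists e => q; have [->|_] := eqVneq q e; rewrite ?eqxx.
exists `|denq e|%N; split; first by rewrite absz_gt0 denq_eq0.
move=> q; have [-> _|_] := eqVneq q e; last by rewrite eqxx.
by exists (numq e); rewrite pmulrn absz_denq divq_num_den.
Qed.

Lemma Kconst_puiseux c : is_puiseux (Kconst c).
Proof.
rewrite /Kconst; split; last by exists 0 => q; have [->|_] := eqVneq q 0; rewrite ?eqxx.
exists 1%N; split=> // q; have [-> _|_] := eqVneq q 0; last by rewrite eqxx.
by exists 0; rewrite mul0r.
Qed.

Lemma KmulC a b : is_puiseux a -> is_puiseux b -> Kmul a b = Kmul b a.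
Proof.
move=> ha hb; have [N [M [N0 [sa sb _]]]] := puiseux_common ha hb hb.
have [s1 h1] := Kmul_crd N0 sa sb; have [s2 h2] := Kmul_crd N0 sb sa.
by apply: psupp_ext s1 s2 _ => k; rewrite (h1 k) // (h2 k) // mulrC.
Qed.

Lemma KmulA a b c : is_puiseux a -> is_puiseux b -> is_puiseux c ->
  Kmul a (Kmul b c) = Kmul (Kmul a b) c.
Proof.
move=> ha hb hc; have [N [M [N0 [sa sb sc]]]] := puiseux_common ha hb hc.
have [s1 h1] := Kmul_crd N0 sb sc; have [s2 h2] := Kmul_crd N0 sa s1.
have [s3 h3] := Kmul_crd N0 sa sb; have [s4 h4] := Kmul_crd N0 s3 sc.
rewrite addnA in s2 h2.
apply: psupp_ext s2 s4 _ => k; rewrite (h2 k) // (h4 k) //.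
set A := trp k (crd N M a); set B := trp k (crd N M b); set C := trp k (crd N M c).
rewrite (@coefM_eqlow _ A _ (B * C) k) //; last by move=> i hi; rewrite coef_trp // (h1 k).
rewrite mulrA; apply: (@coefM_eqlow _ _ _ _ k) => // i hi.
by rewrite coef_trp // (h3 k).
Qed.

Lemma KmulDl a b c : is_puiseux a -> is_puiseux b -> is_puiseux c ->
  Kmul (Kadd a b) c = Kadd (Kmul a c) (Kmul b c).
Proof.
move=> ha hb hc; have [N [M [N0 [sa sb sc]]]] := puiseux_common ha hb hc.
have [s1 h1] := Kmul_crd N0 (Kadd_psupp sa sb) sc.
have [s2 h2] := Kmul_crd N0 sa sc; have [s3 h3] := Kmul_crd N0 sb sc.
apply: psupp_ext s1 (Kadd_psupp s2 s3) _ => k.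
rewrite (h1 k) // crdD (h2 k) // (h3 k) // -coefD -mulrDl.
apply: (@coefM_eqlow _ _ _ _ k) => // i hi.
by rewrite coefD !coef_trp // crdD.
Qed.

Lemma Kmul_Kt e (a : K) q : Kmul (Kt e) a q = a (q - e).
Proof.
rewrite (@Kmul_seq _ _ _ [:: e]) // ?big_seq1 /Kt ?eqxx ?mul1r //.
by move=> p; rewrite inE => /negbTE->; rewrite mul0r.
Qed.

Lemma Kmul1 a : Kmul K1 a = a.
Proof.
apply: Kext => q; have -> : K1 = Kt 0 by [].
by rewrite Kmul_Kt subr0.
Qed.

Record pser : Type := Pser { psv :> K; psvP : is_puiseux psv }.

Lemma pser_eq (x y : pser) : psv x = psv y -> x = y.
Proof.
case: x y => [a pa] [b pb] /= E; move: pa pb; rewrite E => pa pb.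
by rewrite (Prop_irrelevance pa pb).
Qed.

Definition peq (x y : pser) : bool := locked `[< x = y >].

Fact peqP : eq_axiom peq.
Proof. by move=> x y; rewrite /peq -lock; exact: asboolP. Qed.

HB.instance Definition _ := hasDecEq.Build pser peqP.
HB.instance Definition _ := gen_choiceMixin pser.

Definition padd (x y : pser) := Pser (Kadd_puiseux (psvP x) (psvP y)).
Definition popp (x : pser) := Pser (Kopp_puiseux (psvP x)).
Definition pmul (x y : pser) := Pser (Kmul_puiseux (psvP x) (psvP y)).
Definition p0 := Pser K0_puiseux.
Definition pconst c := Pser (Kconst_puiseux c).
Definition pt e := Pser (Kt_puiseux e).

Fact paddA : associative padd.
Proof. by move=> x y z; apply: pser_eq; apply: Kext => q; rewrite /= /Kadd addrA. Qed.
Fact paddC : commutative padd.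
Proof. by move=> x y; apply: pser_eq; apply: Kext => q; rewrite /= /Kadd addrC. Qed.
Fact padd0 : left_id p0 padd.
Proof. by move=> x; apply: pser_eq; apply: Kext => q; rewrite /= /Kadd add0r. Qed.
Fact paddN : left_inverse p0 popp padd.
Proof. by move=> x; apply: pser_eq; apply: Kext => q; rewrite /= /Kadd /Kopp addNr. Qed.

HB.instance Definition _ := GRing.isZmodule.Build pser paddA paddC padd0 paddN.

Fact pmulA : associative pmul.
Proof. by move=> x y z; apply: pser_eq; apply: KmulA; apply: psvP. Qed.
Fact pmulC : commutative pmul.
Proof. by move=> x y; apply: pser_eq; apply: KmulC; apply: psvP. Qed.
Fact pmul1 : left_id (pconst 1) pmul.
Proof. by move=> x; apply: pser_eq; apply: Kmul1. Qed.
Fact pmulDl : left_distributive pmul padd.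
Proof. by move=> x y z; apply: pser_eq; apply: KmulDl; apply: psvP. Qed.
Fact p1_neq0 : pconst 1 != p0.
Proof.
apply/negP => /eqP /(congr1 (fun x => psv x 0)); rewrite /= /Kconst /K0 eqxx => h.
by have := oner_neq0 Cx; rewrite h eqxx.
Qed.

HB.instance Definition _ :=
  GRing.Zmodule_isComNzRing.Build pser pmulA pmulC pmul1 pmulDl p1_neq0.

Lemma psvD (x y : pser) : psv (x + y) = Kadd x y. Proof. by []. Qed.
Lemma psvN (x : pser) : psv (- x) = Kopp x. Proof. by []. Qed.
Lemma psvM (x y : pser) : psv (x * y) = Kmul x y. Proof. by []. Qed.
Lemma psv1 : psv 1 = K1. Proof. by []. Qed.

Lemma pt_coef e (x : pser) q : psv (pt e * x) q = psv x (q - e).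
Proof. by rewrite psvM Kmul_Kt. Qed.

Lemma ptD e e' : pt e * pt e' = pt (e + e').
Proof.
apply: pser_eq; apply: Kext => q; rewrite pt_coef /= /Kt.
by rewrite subr_eq addrC.
Qed.

(* The sequence [w] is built so that [w ^ 2 * u = 1] holds modulo ever higher
   powers: each new coefficient enters linearly, with slope [2 * u 0 * w 0]. *)
Lemma inv_sqrt_seq (u : nat -> Cx) : u 0%N != 0 ->
  exists w : nat -> Cx, forall n, (trp n w ^+ 2 * trp n u)`_n = (n == 0%N)%:R.
Proof.
move=> u0; pose w0 : Cx := sqrtC (u 0%N)^-1.
have w0E : w0 ^+ 2 * u 0%N = 1 by rewrite sqrtCK mulVf.
have w0n : w0 != 0 by apply: contra_eq_neq w0E => ->; rewrite expr0n mul0r eq_sym oner_eq0.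
pose c (p : {poly Cx}) n := - (p ^+ 2 * trp n u)`_n / (2 * u 0%N * w0).
pose P := fix P n := if n is m.+1 then P m + c (P m) n *: 'X^n else w0%:P.
pose w n := (P n)`_n.
have sP n : (size (P n) <= n.+1)%N.
  elim: n => [|n IH] /=; first exact: size_polyC_leq1.
  rewrite (leq_trans (size_polyD _ _)) // geq_max (leq_trans IH) //=.
  by rewrite (leq_trans (size_scale_leq _ _)) // size_polyXn.
have Pstab n i : (i <= n)%N -> (P n)`_i = w i.
  elim: n => [|n IH]; first by rewrite leqn0 => /eqP->.
  rewrite leq_eqVlt => /predU1P[-> //|]; rewrite ltnS => hi.
  by rewrite coefD coefZ coefXn (IH hi) ltn_eqF ?mulr0 ?addr0 // ltnS.
have PE n : trp n w = P n.
  apply/polyP => i; have [hi|hi] := leqP i n; first by rewrite coef_trp // Pstab.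
  by rewrite coef_poly ltnNge hi nth_default // (leq_trans (sP n)).
exists w => -[|n]; rewrite PE; first by rewrite -[P 0%N]/w0%:P expr2 -polyCM coefCM coef_trp // -expr2.
set q := trp n.+1 u.
have -> : P n.+1 = P n + c (P n) n.+1 *: 'X^(n.+1) by [].
set cc := c _ _.
(* In degree [n.+1] the term quadratic in [cc] contributes nothing, and the linear one contributes
   [2 * cc * w0 * u 0]. *)
have -> : (P n + cc *: 'X^(n.+1)) ^+ 2 * q =
   P n ^+ 2 * q + (cc + cc) *: (P n * q * 'X^(n.+1)) + (cc ^+ 2) *: (q * 'X^(n.+1) * 'X^(n.+1)).
  move: (P n) q 'X^(n.+1) cc => A B C D.
  rewrite -!mul_polyC !expr2 polyCM polyCD. ring.
rewrite !coefD !coefZ !coefMXn ltnn subnn ltn0Sn coef0M mulr0 addr0.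
have -> : (P n)`_0 = w0 by rewrite Pstab // /w coefC.
have -> : q`_0 = u 0%N by rewrite coef_trp.
rewrite /cc /c -/q; set z := (_ * q)`_n.+1; set v := u 0%N.
have -> : (n.+1 == 0)%:R = 0 :> Cx by [].
by field; rewrite w0n u0.
Qed.

(** The exponents are [M - k / N] with [k] natural, so the least [k] with a nonzero coefficient
    gives the leading one. *)
Lemma pser_led (x : pser) : x != 0 -> exists e c, c != 0 /\ led x e c.
Proof.
move=> x0; have [N [M [N0 h]]] := puiseux_psupp (psvP x).
have ex : exists k, crd N M x k != 0.
  apply: contrapT => /forallNP hk; case/eqP: x0; apply: pser_eq.
  apply: Kext => q; apply/eqP; apply/negPn/negP => xq.
  by have [k qE] := h q xq; apply: (hk k); rewrite /crd -qE.
case: (ex_minnP ex) => k hk hmin; exists (M%:R - k%:R / N%:R), (crd N M x k).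
split=> //; split=> // q hq; apply/eqP; apply: contraTT hq => xq; have [j qE] := h q xq.
rewrite -leNgt qE lerD2l lerN2 ler_pM2r ?invr_gt0 ?ltr0n // ler_nat hmin //.
by rewrite /crd -qE.
Qed.

(** After division by the leading power of [t], the coefficients come from [inv_sqrt_seq]. This one
    construction provides inverses, square roots and the scaling of a matrix to determinant 1. *)
Lemma pser_inv_sqrt (x : pser) : x != 0 -> exists w : pser, w ^+ 2 * x = 1.
Proof.
move=> x0; have [e [c [c0 [hx xe]]]] := pser_led x0.
pose y := pt (- e) * x.
have y0 : psv y 0 = c by rewrite pt_coef sub0r opprK.
have [N [M [N0 h]]] := puiseux_psupp (psvP y).
have n0 := natr_neq0 N0.
have sy : psupp N 0 y.
  move=> q yq; have [k qE] := h q yq.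
  have : (k%:R : rat) >= (M * N)%:R.
    rewrite leNgt; apply: contraNN yq; rewrite natrM -ltr_pdivrMr ?ltr0n // => hk.
    by rewrite pt_coef hx // qE; lra.
  rewrite ler_nat => hk; exists (k - M * N)%N; rewrite qE natrB // natrM; field.
  exact: n0.
have u0 : crd N 0 y 0 != 0 by rewrite /crd mul0r subr0 y0.
have [w hw] := inv_sqrt_seq u0.
(* The value [w k] is placed at the exponent [- k / N], and 0 elsewhere. *)
pose a : K := fun q => if - q * N%:R \is a Num.nat then w (Num.trunc (- q * N%:R)) else 0.
have ca k : crd N 0 a k = w k.
  by rewrite /crd /a sub0r opprK divfK // natrK natr_nat.
have sa : psupp N 0 a.
  move=> q; rewrite /a; case: natrP => [[k E] _|]; last by rewrite eqxx.
  by exists k; rewrite -E; field.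
pose v := Pser (psupp_puiseux N0 sa).
exists (pt (- e / 2) * v).
have E : v ^+ 2 * y = 1.
  have [s1 h1] := Kmul_crd N0 sa sa; have [s2 h2] := Kmul_crd N0 s1 sy.
  apply: pser_eq; have s3 : psupp N 0 (1 : pser).
    move=> q; rewrite psv1 /K1 /Kconst; have [-> _|_] := eqVneq q 0; last by rewrite eqxx.
    by exists 0%N; rewrite mul0r subr0.
  rewrite expr2; apply: psupp_ext s2 s3 _ => k; rewrite (h2 k) //.
  rewrite (@coefM_eqlow _ (trp k w ^+ 2) _ (trp k (crd N 0 y)) k) // ?hw.
    rewrite /crd sub0r psv1 /K1 /Kconst oppr_eq0 mulf_eq0 invr_eq0 (negPf n0) orbF.
    by rewrite pnatr_eq0; case: eqP.
  have tE : trp k (crd N 0 a) = trp k w by apply: eq_poly => i _; rewrite ca.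
  by move=> i hi; rewrite coef_trp // (h1 k) // tE expr2.
rewrite -[RHS]E /y exprMn expr2 ptD -!mulrA; have -> : - e / 2 + - e / 2 = - e by field.
by rewrite mulrCA; congr (_ * _); rewrite mulrCA.
Qed.

Definition pinv (x : pser) : pser :=
  if pselect (exists w : pser, w ^+ 2 * x = 1) is left h then (sval (cid h)) ^+ 2 else 0.

Fact pinvP (x : pser) : x != 0 -> pinv x * x = 1.
Proof.
move=> x0; rewrite /pinv; case: pselect => [h|[]]; last exact: pser_inv_sqrt.
exact: (svalP (cid h)).
Qed.

Fact pinv0 : pinv 0 = 0.
Proof.
rewrite /pinv; case: pselect => // h; exfalso; case: h => w /eqP.
by rewrite mulr0 eq_sym oner_eq0.
Qed.

HB.instance Definition _ := GRing.ComNzRing_isField.Build pser pinvP pinv0.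

Lemma pser_sqrt (x : pser) : exists s : pser, s ^+ 2 = x.
Proof.
have [->|x0] := eqVneq x 0; first by exists 0; rewrite expr0n.
have [w hw] := pser_inv_sqrt x0; exists (w * x).
by rewrite exprMn [x ^+ 2]expr2 mulrA hw mul1r.
Qed.

(** * Leading terms of matrices and of the equation of the surface *)

(** The tropical principle: at the exponent [tau] only the terms that reach it contribute. *)
Lemma led_sum_max (I : eqType) (r : seq I) (F : I -> K) (t : I -> rat) (c : I -> Cx) tau :
  (forall i, i \in r -> led (F i) (t i) (c i)) -> (forall i, i \in r -> t i <= tau) ->
  led (\big[Kadd/K0]_(i <- r) F i) tau (\sum_(i <- r | t i == tau) c i).
Proof.
elim: r => [|i r IH] hF ht; first by rewrite !big_nil; exact: led0.
rewrite !big_cons.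
have h : led (\big[Kadd/K0]_(j <- r) F j) tau (\sum_(j <- r | t j == tau) c j).
  by apply: IH => j hj; [apply: hF|apply: ht]; rewrite inE hj orbT.
have Fi := hF i (mem_head i r).
have := ht i (mem_head i r); case: ltgtP => // [lt_i|E] _.
  by rewrite -[X in led _ _ X]add0r; apply: led_add => //; apply: led_weak Fi lt_i.
by apply: led_add => //; rewrite -E.
Qed.

Definition ledm (A : 'M[K]_2) (e : rat) (M : 'M[Cx]_2) := forall i j, led (A i j) e (M i j).

Definition mdet (R : pzRingType) (M : 'M[R]_2) : R := M i0 i0 * M i1 i1 - M i0 i1 * M i1 i0.

Lemma ledm_det A e M : ledm A e M -> led (Kdet A) (e + e) (mdet M).
Proof.
move=> h; apply: led_add; first exact: led_mul.
by apply: led_opp; apply: led_mul.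
Qed.

Definition mvec (M : 'M[Cx]_2) (i : 'I_4) : Cx := M (entry_of i).1 (entry_of i).2.

Lemma led_Keval f A e M k : homog_deg k f -> ledm A e M ->
  led (Keval f A) (e *+ k) (f.@[mvec M]).
Proof.
move=> /allP hf hA; rewrite mevalE.
have -> : \sum_(m <- msupp f) f@_m * \prod_i mvec M i ^+ m i =
   \sum_(m <- msupp f | (fun=> e *+ k) m == e *+ k) f@_m * \prod_i mvec M i ^+ m i.
  by apply: eq_bigl => m; rewrite eqxx.
apply: led_sum_max => // m /hf /eqP hm.
rewrite -[e *+ k]add0r; apply: led_mul; first exact: led_const.
rewrite -hm mdegE -sumrMnr; apply: led_prod => i; exact: led_exp.
Qed.

Lemma homog_scale f k (z : Cx) (v w : 'I_4 -> Cx) : homog_deg k f ->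
  (forall i, w i = z * v i) -> f.@[w] = z ^+ k * f.@[v].
Proof.
move=> /allP hf hw; rewrite !mevalE big_distrr /=; apply: eq_big_seq => m /hf /eqP hm.
rewrite mulrCA; congr (_ * _); rewrite -hm mdegE -prodrXr -big_split /=.
by apply: eq_bigr => i _; rewrite hw exprMn.
Qed.

Section Surface.
Variables (d : nat) (f : 'I_(d./2).+1 -> {mpoly Cx[4]}).
Notation n := (d./2).
Notation dg j := (2 * j + odd d)%N.
Hypothesis hf : forall j : 'I_n.+1, homog_deg (dg j) (f j).

Definition gval (j : 'I_n.+1) (M : 'M[Cx]_2) : Cx := (f j).@[mvec M].

Lemma gval_scale j z (M N : 'M[Cx]_2) : M = z *: N -> gval j M = z ^+ dg j * gval j N.
Proof. by move=> ->; apply: homog_scale (hf j) _ => i; rewrite /mvec mxE. Qed.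

(** Exponent of the [j]-th term of the equation at level [al], up to a summand independent of [j].
    By [texp_sub], the terms [j - 1] and [j] tie exactly at [al = j]. *)
Definition texp (al : rat) (j : nat) : rat := al *+ 2 *+ j - (j * j.+1)%N%:R.

Lemma texp_sub al (i j : nat) : texp al j - texp al i =
  (j%:R - i%:R) * (al *+ 2 - (i%:R + j%:R + 1)).
Proof.
rewrite /texp !natrM -!natr1 -![_ *+ _ *+ _]mulr_natr; ring.
Qed.

Lemma surf_led A ga M de e : ledm A ga M -> led (Kdet A) de e -> surfF f A = K0 ->
  forall tau, (forall j : 'I_n.+1, texp (ga - de / 2) j <= tau) ->
  \sum_(j < n.+1 | texp (ga - de / 2) j == tau) e ^+ (n - j) * gval j M = 0.
Proof.
move=> hA hd hS tau htau; pose b := de *+ n + ga *+ odd d.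
pose t (j : 'I_n.+1) : rat := - ((j * j.+1)%N)%:R + (de *+ (n - j) + ga *+ dg j).
have tE j : t j = b + texp (ga - de / 2) j.
  have le_jn : (j <= n)%N by rewrite -ltnS.
  by rewrite /t /b /texp mulrnBr //; field.
have := @led_sum_max _ (index_enum 'I_n.+1) (fun j => Kmul (Kt (- ((j * j.+1)%N)%:R))
   (Kmul (Kpow (Kdet A) (n - j)) (Keval (f j) A))) t (fun j => e ^+ (n - j) * gval j M) (b + tau).
rewrite -[X in led X]/(surfF f A) hS => h.
have /led_uniq E : led K0 (b + tau) (\sum_(j < n.+1 | t j == b + tau) e ^+ (n - j) * gval j M).
  apply: h => j _; last by rewrite tE lerD2l.
  rewrite -[_ * gval _ _]mul1r; apply: led_mul; first exact: led_Kt.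
  by apply: led_mul; [exact: led_exp|exact: led_Keval].
rewrite -[RHS](E _ (led0 (b + tau))); apply: eq_bigl => j.
by rewrite tE (inj_eq (addrI b)).
Qed.

Lemma texp_lt (al : rat) (j : 'I_n.+1) :
  (j == 0%N :> nat) || (j%:R < al) -> (j == n :> nat) || (al < j.+1%:R) ->
  forall i : 'I_n.+1, i != j -> texp al i < texp al j.
Proof.
move=> hl hr i ij; rewrite -subr_gt0 texp_sub.
have ij' : (i != j :> nat) by [].
have [lt|gt|E] := ltngtP (i : nat) (j : nat); last by rewrite E eqxx in ij'.
- have h : i%:R + 1 <= j%:R :> rat by rewrite natr1 ler_nat.
  have h2 : j%:R < al by case/orP: hl => // /eqP j0; rewrite j0 in lt.
  by apply: mulr_gt0; rewrite subr_gt0; lra.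
- have h : j%:R + 1 <= i%:R :> rat by rewrite natr1 ler_nat.
  have h2 : al < j%:R + 1.
    rewrite natr1; case/orP: hr => // /eqP jn; have := ltn_ord i; move: gt jn; lia.
  by rewrite -mulrNN; apply: mulr_gt0; rewrite oppr_gt0 subr_lt0; lra.
Qed.

(** The [j]-th term strictly dominates, so its coefficient [e ^ (n - j) * gval j M] must vanish. For
    [j = n] the power of [e] is 1, so [e = 0] is allowed. *)
Lemma surf_open A ga M de e (j : 'I_n.+1) : ledm A ga M -> led (Kdet A) de e ->
  surfF f A = K0 -> (e != 0) || (j == n :> nat) ->
  (j == 0%N :> nat) || (j%:R < ga - de / 2) ->
  (j == n :> nat) || (ga - de / 2 < j.+1%:R) -> gval j M = 0.
Proof.
move=> hA hd hS e0 hl hr; have hlt := texp_lt hl hr.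
have := surf_led hA hd hS (tau := texp (ga - de / 2) j).
rewrite (bigD1 j) //= big1 => [|i /andP[/eqP E ij]]; last first.
  by have := hlt i ij; rewrite E ltxx.
rewrite addr0 => h; have /eqP : e ^+ (n - j) * gval j M = 0.
  by apply: h => i; have [->|/hlt/ltW] := eqVneq i j.
rewrite mulf_eq0 expf_eq0; case/orP: e0 => [/negPf->|/eqP->].
  by rewrite andbF => /eqP.
by rewrite subnn => /eqP.
Qed.

Lemma surf_null A ga M : ledm A ga M -> Kdet A = K0 -> surfF f A = K0 ->
  gval ord_max M = 0.
Proof.
(* For the zero determinant, [led] holds at any exponent with coefficient 0; this choice puts the
   level at [n + 1]. *)
move=> hA hd hS; apply: (@surf_open _ ga M (2 * (ga - n%:R - 1)) 0 _ hA) => //=.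
- by rewrite hd; exact: led0.
- by rewrite !eqxx.
- by apply/orP; right; lra.
- by rewrite eqxx.
Qed.

(** At the level [j] exactly the terms [j - 1] and [j] are dominant, and their powers of [e] differ
    by one factor. *)
Lemma surf_wall A ga M de e (i j : 'I_n.+1) : ledm A ga M -> led (Kdet A) de e ->
  surfF f A = K0 -> e != 0 -> j = i.+1 :> nat -> ga - de / 2 = j%:R ->
  gval j M = - (e * gval i M).
Proof.
move=> hA hd hS e0 ji hal.
have hle (k : 'I_n.+1) : k != i -> k != j -> texp (ga - de / 2) k < texp (ga - de / 2) j.
  move=> ki kj; rewrite -subr_gt0 texp_sub hal.
  have ki' : k != i :> nat by []. have kj' : k != j :> nat by [].
  have [lt|gt|E] := ltngtP (k : nat) (j : nat); last by rewrite E eqxx in kj'.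
    have h : k%:R + 2 <= j%:R :> rat by rewrite -natrD ler_nat; lia.
    by apply: mulr_gt0; rewrite subr_gt0; lra.
  have h : j%:R + 1 <= k%:R :> rat by rewrite natr1 ler_nat.
  by rewrite -mulrNN; apply: mulr_gt0; rewrite oppr_gt0 subr_lt0; lra.
have eqij : texp (ga - de / 2) i = texp (ga - de / 2) j.
  apply/eqP; rewrite eq_sym -subr_eq0 texp_sub hal ji -natr1; apply/eqP; ring.
have nij : i != j by rewrite -val_eqE /= ji; lia.
have := surf_led hA hd hS (tau := texp (ga - de / 2) j).
rewrite (bigD1 j) //= (bigD1 i) /= ?eqij ?eqxx // big1 => [|k /andP[/andP[/eqP E kj] ki]]; last first.
  by have := hle k ki kj; rewrite E ltxx.
rewrite addr0 => h; have /eqP : e ^+ (n - j) * gval j M + e ^+ (n - i) * gval i M = 0.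
  apply: h => k; have [->|ki] := eqVneq k i; first by rewrite eqij.
  by have [->|kj] := eqVneq k j => //; apply: ltW; apply: hle.
have -> : (n - i = (n - j).+1)%N by rewrite ji; have := ltn_ord j; lia.
rewrite exprSr -mulrA -mulrDr mulf_eq0 expf_eq0 (negPf e0) andbF /= addr_eq0.
by move/eqP.
Qed.

End Surface.

(** * Recovering the phase from the polar form [E N + E^-1 (N^c)^*] *)

Section Polar.
Variable (C : numClosedFieldType).
Implicit Types a b c d z E : C.

Lemma mul_conj_sum_ge0 a b c d :
  0 <= a * a^* + b * b^* + c * c^* + d * d^*.
Proof. by rewrite !addr_ge0 ?mul_conjC_ge0. Qed.

(** Compare determinants and squared norms of both sides. The norm is [E ^ 2 + E ^ -2] times the
    determinant, which forces [z] to be real and [E1 = E2]; the entries then solve a linear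
    system. *)
Lemma polar_inj (E1 E2 a b c d a' b' c' d' z : C) :
  1 < E1 -> 1 <= E2 -> a * d - b * c = 0 ->
  [|| a != 0, b != 0, c != 0 | d != 0] ->
  (E2 != 1 -> a' * d' - b' * c' = 0) -> (E2 = 1 -> a' * d' - b' * c' = 1) -> z != 0 ->
  E1 * a + E1^-1 * d^* = z * (E2 * a' + E2^-1 * d'^*) ->
  E1 * b - E1^-1 * c^* = z * (E2 * b' - E2^-1 * c'^*) ->
  E1 * c - E1^-1 * b^* = z * (E2 * c' - E2^-1 * b'^*) ->
  E1 * d + E1^-1 * a^* = z * (E2 * d' + E2^-1 * a'^*) ->
  [/\ E1 = E2, z^* = z & [/\ a = z * a', b = z * b', c = z * c' & d = z * d']].
Proof.
move=> hE1 hE2 D1 nz1 D2 D2' z0 e00 e01 e10 e11.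
have E10 : 0 < E1 by apply: lt_trans hE1.
have E20 : 0 < E2 by apply: lt_le_trans hE2.
have nE1 : E1 != 0 by rewrite gt_eqF.
have nE2 : E2 != 0 by rewrite gt_eqF.
have cE1 : E1^* = E1 by apply: conj_Creal; rewrite gtr0_real.
have cE2 : E2^* = E2 by apply: conj_Creal; rewrite gtr0_real.
have cD x y : (x + y)^* = x^* + y^* :> C by rewrite rmorphD.
have cN x : (- x)^* = - x^* :> C by rewrite rmorphN.
have cM x y : (x * y)^* = x^* * y^* :> C by rewrite rmorphM.
have cV x : (x^-1)^* = (x^*)^-1 :> C by rewrite fmorphV.
have conj := (cD, cN, cM, cV, @conjCK C, cE1, cE2).
have f00 := congr1 (fun x => x^*) e00. have f01 := congr1 (fun x => x^*) e01.
have f10 := congr1 (fun x => x^*) e10. have f11 := congr1 (fun x => x^*) e11.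
rewrite /= !conj in f00 f01 f10 f11.
have D1c : a^* * d^* - b^* * c^* = 0 by rewrite -!rmorphM -rmorphB D1 rmorph0.
set n1 := a * a^* + b * b^* + c * c^* + d * d^*.
set n2 := a' * a'^* + b' * b'^* + c' * c'^* + d' * d'^*.
pose d2 := a' * d' - b' * c'.
have d2c : d2^* = a'^* * d'^* - b'^* * c'^* by rewrite /d2 !conj.
pose m2 := n2 + E2 ^+ 2 * d2 + E2 ^- 2 * d2^*.
pose r1 := E1 ^+ 2 + E1 ^- 2; pose r2 := E2 ^+ 2 + E2 ^- 2.
have n1_neq0 : n1 != 0.
  rewrite /n1 !paddr_eq0 ?addr_ge0 ?mul_conjC_ge0 // !mul_conjC_eq0.
  by rewrite !negb_and -!orbA.
(* Equality of the determinants; the one on the left is the squared norm [n1] because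
   [a * d - b * c = 0]. *)
have detE : n1 = z ^+ 2 * m2.
  have -> : n1 = (E1 * a + E1^-1 * d^*) * (E1 * d + E1^-1 * a^*) -
      (E1 * b - E1^-1 * c^*) * (E1 * c - E1^-1 * b^*) - E1 ^+ 2 * (a * d - b * c)
      - E1 ^- 2 * (a^* * d^* - b^* * c^*).
    by rewrite /n1; field.
  rewrite D1 D1c e00 e01 e10 e11 /m2 d2c /d2 /n2; field; by rewrite ?nE1 ?nE2.
have m2_neq0 : m2 != 0 by apply: contraNneq n1_neq0 => m20; rewrite detE m20 mulr0.
have nrm2 : n2 * r2 + 2 * d2 + 2 * d2^* = r2 * m2.
  rewrite /m2 /r2; have [E2E|E2n] := eqVneq E2 1; last first.
    by rewrite /d2 D2 // rmorph0; ring.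
  by rewrite /d2 D2' // E2E rmorph1 expr1n invr1; ring.
(* Equality of the sums of squared moduli of the entries. *)
have nrm : r1 * n1 = z * z^* * (r2 * m2).
  have -> : r1 * n1 = (E1 * a + E1^-1 * d^*) * (E1 * a^* + E1^-1 * d) +
     (E1 * b - E1^-1 * c^*) * (E1 * b^* - E1^-1 * c) +
     (E1 * c - E1^-1 * b^*) * (E1 * c^* - E1^-1 * b) +
     (E1 * d + E1^-1 * a^*) * (E1 * d^* + E1^-1 * a)
     - 2 * (a * d - b * c) - 2 * (a^* * d^* - b^* * c^*).
    by rewrite /r1 /n1; field.
  rewrite D1 D1c e00 e01 e10 e11 f00 f01 f10 f11 -nrm2 d2c /r2 /d2 /n2; field; by rewrite ?nE1 ?nE2.
have r1p : 0 < r1 by rewrite addr_gt0 ?invr_gt0 ?exprn_gt0.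
have r2p : 0 < r2 by rewrite addr_gt0 ?invr_gt0 ?exprn_gt0.
have rz : r1 * z = r2 * z^*.
  apply: (mulfI z0); apply: (mulIf m2_neq0); move: nrm; rewrite detE => h.
  transitivity (r1 * (z ^+ 2 * m2)); first ring. rewrite h; ring.
have rzc : r1 * z^* = r2 * z.
  have := congr1 (fun x => x^*) rz; rewrite /= [(r1 * _)^*]cM [(r2 * _)^*]cM conjCK.
  by rewrite (conj_Creal (gtr0_real r1p)) (conj_Creal (gtr0_real r2p)).
have rE : r1 = r2.
  have : r1 ^+ 2 = r2 ^+ 2.
    apply: (mulIf z0); rewrite !expr2 -!mulrA rz -rzc; ring.
  by move/eqP; rewrite eqrXn2 // ?ltW // => /eqP.
have zR : z^* = z.
  by apply: (mulfI (lt0r_neq0 r2p)); rewrite -rz rE.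
have EE : E1 = E2.
  have : (E1 ^+ 2 - E2 ^+ 2) * (1 - (E1 * E2) ^- 2) = 0.
    have : r1 - r2 = 0 by rewrite rE subrr.
    by rewrite /r1 /r2 => <-; field; rewrite nE1 nE2.
  have h : (1 - (E1 * E2) ^- 2) != 0.
    rewrite subr_eq0 eq_sym lt_eqF // invf_lt1 ?exprn_gt0 ?mulr_gt0 // exprn_egt1 //.
    by apply: lt_le_trans hE1 _; rewrite ler_peMr // ltW.
  move/eqP; rewrite mulf_eq0 (negPf h) orbF subr_eq0 eqrXn2 ?ltW // => /eqP//.
split=> //; rewrite -EE zR in e00 e01 e10 e11 f00 f01 f10 f11.
(* Determinant of the linear system for an entry and the conjugate of the opposite one; it is
   nonzero because [E1 > 1]. *)
have hE : E1 ^+ 2 - E1 ^- 2 != 0.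
  rewrite subr_eq0 gt_eqF // (@lt_trans _ _ 1) ?exprn_egt1 //.
  by rewrite invf_lt1 ?exprn_gt0 // exprn_egt1.
split; apply: (mulfI hE).
- transitivity (E1 * (E1 * a + E1^-1 * d^*) - E1^-1 * (E1 * d^* + E1^-1 * a)); first by field.
  by rewrite e00 f11; field.
- transitivity (E1 * (E1 * b - E1^-1 * c^*) + E1^-1 * (E1 * c^* - E1^-1 * b)); first by field.
  by rewrite e01 f10; field.
- transitivity (E1 * (E1 * c - E1^-1 * b^*) + E1^-1 * (E1 * b^* - E1^-1 * c)); first by field.
  by rewrite e10 f01; field.
- transitivity (E1 * (E1 * d + E1^-1 * a^*) - E1^-1 * (E1 * a^* + E1^-1 * d)); first by field.
  by rewrite e11 f00; field.
Qed.

(** The determinant is the squared norm plus a nonnegative number. Hence the two branches of VAL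
    have disjoint images: singular and invertible matrices. *)
Lemma polar_det_neq0 (E a b c d : C) : 1 <= E -> [|| a != 0, b != 0, c != 0 | d != 0] ->
  (E != 1 -> a * d - b * c = 0) -> (E = 1 -> a * d - b * c = 1) ->
  (E * a + E^-1 * d^*) * (E * d + E^-1 * a^*) -
  (E * b - E^-1 * c^*) * (E * c - E^-1 * b^*) != 0.
Proof.
move=> hE nz D D'.
have E0 : 0 < E by apply: lt_le_trans hE.
have nE : E != 0 by rewrite gt_eqF.
pose n1 := a * a^* + b * b^* + c * c^* + d * d^*.
have n1p : 0 < n1.
  rewrite lt_def mul_conj_sum_ge0 andbT.
  rewrite /n1 !paddr_eq0 ?addr_ge0 ?mul_conjC_ge0 // !mul_conjC_eq0.
  by rewrite !negb_and -!orbA.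
have -> : (E * a + E^-1 * d^*) * (E * d + E^-1 * a^*) -
  (E * b - E^-1 * c^*) * (E * c - E^-1 * b^*) =
  n1 + (E ^+ 2 * (a * d - b * c) + E ^- 2 * (a * d - b * c)^*).
  by rewrite rmorphB !rmorphM /n1 /=; field.
rewrite gt_eqF //; have [E1|En] := eqVneq E 1; last by rewrite D // rmorph0 !mulr0 !addr0.
by rewrite D' // E1 rmorph1 expr1n invr1 !mulr1 (addr_gt0 n1p) // addr_gt0.
Qed.

End Polar.

(** * The map VAL in terms of leading terms *)

Section RealExponential.
Transparent Cx.

Lemma cexpD x y : cexp (x + y) = cexp x * cexp y.
Proof.
have E : Rtrigo_def.exp (ratr (x + y)) =
  Rtrigo_def.exp (ratr x) * Rtrigo_def.exp (ratr y) :> Rdefinitions.R.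
  by rewrite rmorphD; exact: Exp_prop.exp_plus.
by rewrite /cexp E; exact: (rmorphM (real_complex Rdefinitions.R)).
Qed.

Lemma cexp0 : cexp 0 = 1.
Proof. by rewrite /cexp rmorph0 Rtrigo_def.exp_0. Qed.

Lemma cexp_gt1 x : 0 < x -> 1 < cexp x.
Proof.
move=> x0.
have h : (1 : Rdefinitions.R) < Rtrigo_def.exp (ratr x).
  have -> : (1 : Rdefinitions.R) = Rtrigo_def.exp 0 by rewrite Rtrigo_def.exp_0.
  by apply/RltP; apply: Rpower.exp_increasing; apply/RltP; rewrite ltr0q.
by move: h; rewrite -ltcR.
Qed.

End RealExponential.

Lemma cexpN x : cexp (- x) = (cexp x)^-1.
Proof.
have h : cexp x * cexp (- x) = 1 by rewrite -cexpD subrr cexp0.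
have x0 : cexp x != 0 by apply: contra_eq_neq h => ->; rewrite mul0r eq_sym oner_neq0.
by apply: (mulfI x0); rewrite h mulfV.
Qed.

Lemma cexp_ge1 x : 0 <= x -> 1 <= cexp x.
Proof. by rewrite le_eqVlt => /predU1P[<-|/cexp_gt1/ltW//]; rewrite cexp0. Qed.

Lemma cexp_lt x y : x < y -> cexp x < cexp y.
Proof.
move=> xy; have -> : y = x + (y - x) by ring.
have h z : 0 < cexp z.
  case: (ltgtP z 0) => [z0|/cexp_gt1 h|->]; last by rewrite cexp0.
    by rewrite -[z]opprK cexpN invr_gt0 (lt_trans _ (cexp_gt1 _)) // oppr_gt0.
  exact: lt_trans h.
by rewrite cexpD ltr_pMr // cexp_gt1 // subr_gt0.
Qed.

Lemma cexp_inj : injective cexp.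
Proof.
by move=> x y E; case: (ltgtP x y) => // /cexp_lt; rewrite E ltxx.
Qed.

Lemma mx2_eq (R : Type) (M N : 'M[R]_2) : M i0 i0 = N i0 i0 -> M i0 i1 = N i0 i1 ->
  M i1 i0 = N i1 i0 -> M i1 i1 = N i1 i1 -> M = N.
Proof.
have I2 (i : 'I_2) : i = i0 \/ i = i1.
  by case: i => [[|[|i]] hi] //; [left|right]; apply: val_inj.
by move=> *; apply/matrixP => i j; case: (I2 i) => ->; case: (I2 j) => ->.
Qed.

Lemma mx2_neq0 (M : 'M[Cx]_2) :
  (M != 0) = [|| M i0 i0 != 0, M i0 i1 != 0, M i1 i0 != 0 | M i1 i1 != 0].
Proof.
apply/idP/idP => [|h]; last first.
  by apply: contraTneq h => ->; rewrite !mxE eqxx.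
apply: contraNT; rewrite !negb_or !negbK => /and4P[/eqP h1 /eqP h2 /eqP h3 /eqP h4].
by apply/eqP; apply: mx2_eq; rewrite !mxE.
Qed.

Definition polar (E : Cx) (N : 'M[Cx]_2) : 'M[Cx]_2 := E *: N + E^-1 *: mx_star (mxc N).

Lemma polarE E N : [/\ polar E N i0 i0 = E * N i0 i0 + E^-1 * (N i1 i1)^*,
   polar E N i0 i1 = E * N i0 i1 - E^-1 * (N i1 i0)^*,
   polar E N i1 i0 = E * N i1 i0 - E^-1 * (N i0 i1)^* &
   polar E N i1 i1 = E * N i1 i1 + E^-1 * (N i0 i0)^*].
Proof. by rewrite /polar /mx_star /mxc !mxE /= !rmorphN !mulrN. Qed.

Lemma lead_uniq A ga M : ledm A ga M -> M != 0 -> lead_exp A = ga /\ lead_mx A = M.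
Proof.
move=> hA M0.
have [[i [j hij]] hlt] : (exists i j, A i j (lead_exp A) <> 0) /\
    forall i j (q : rat), lead_exp A < q -> A i j q = 0.
  apply: (ClassicalEpsilon.epsilon_spec (inhabits 0) (fun alpha =>
     (exists i j, A i j alpha <> 0) /\ forall i j (q : rat), alpha < q -> A i j q = 0)).
  exists ga; split=> [|i j q]; last by case: (hA i j) => h _; apply: h.
  move: M0; rewrite mx2_neq0 => /or4P[]/eqP h;
    [exists i0, i0|exists i0, i1|exists i1, i0|exists i1, i1];
    by rewrite (proj2 (hA _ _)).
have E : lead_exp A = ga.
  have [h|h|//] := ltgtP (lead_exp A) ga; last by case: hij; apply: (proj1 (hA i j)).
  move: M0; rewrite mx2_neq0; suff Mz k l : M k l = 0 by rewrite !Mz eqxx.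
  by rewrite -(proj2 (hA k l)); apply: hlt.
by split=> //; apply/matrixP => k l; rewrite mxE E (proj2 (hA k l)).
Qed.

Definition kmx (A : 'M[pser]_2) : 'M[K]_2 := map_mx psv A.

Lemma kmx_det A : Kdet (kmx A) = psv (mdet A).
Proof. by rewrite /Kdet !mxE. Qed.

Lemma kmx_scale (l : pser) A : Kscale l (kmx A) = kmx (l *: A).
Proof. by apply/matrixP => i j; rewrite !mxE. Qed.

Lemma kmx_add A B : Kmxadd (kmx A) (kmx B) = kmx (A + B).
Proof. by apply/matrixP => i j; rewrite !mxE. Qed.

Lemma puiseux_kmx A : Kmx_puiseux A -> exists A', A = kmx A'.
Proof.
move=> hA; exists (\matrix_(i, j) Pser (hA i j)).
by apply/matrixP => i j; rewrite !mxE.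
Qed.

Lemma mdetZ (R : comPzRingType) (s : R) (A : 'M[R]_2) : mdet (s *: A) = s ^+ 2 * mdet A.
Proof. rewrite /mdet !mxE; ring. Qed.

Lemma VALrep_null A ga M : ledm A ga M -> M != 0 -> Kdet A = K0 -> VALrep A = M.
Proof.
by move=> hA M0 dA; rewrite /VALrep; case: pselect => //= h; exact: (lead_uniq hA M0).2.
Qed.

(** The factor that scales the determinant to 1 has leading term [s * t ^ (- de / 2)] with
    [s ^ 2 * e = 1]; this holds for whichever root the choice operator returns. *)
Lemma VALrep_nz (A : 'M[pser]_2) ga M de e : ledm (kmx A) ga M -> M != 0 ->
  led (Kdet (kmx A)) de e -> e != 0 ->
  exists s, s ^+ 2 * e = 1 /\ VALrep (kmx A) = polar (cexp (ga - de / 2)) (s *: M).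
Proof.
move=> hA M0; rewrite kmx_det => hd e0.
have dA : mdet A != 0.
  by apply: contra_neq e0 => d0; move: hd; rewrite d0 => /led_uniq; apply; exact: led0.
rewrite /VALrep kmx_det; case: pselect => [h|h] /=.
  by case/eqP: dA; apply: pser_eq.
have [s_p sK] : is_puiseux (det1_scale (kmx A)) /\
    Kdet (Kscale (det1_scale (kmx A)) (kmx A)) = K1.
  apply: (ClassicalEpsilon.epsilon_spec (inhabits K0)
    (fun s => is_puiseux s /\ Kdet (Kscale s (kmx A)) = K1)).
  have [w hw] := pser_inv_sqrt dA; exists w; split; first exact: psvP.
  by rewrite kmx_scale kmx_det mdetZ hw.
set s' := Pser s_p; have -> : det1_scale (kmx A) = psv s' by [].
have sE : s' ^+ 2 * mdet A = 1.
  by apply: pser_eq; rewrite -mdetZ -kmx_det -kmx_scale.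
have s0 : s' != 0.
  by apply: contra_eq_neq sE => ->; rewrite expr0n mul0r eq_sym oner_neq0.
have [sg [c [c0 hs]]] := pser_led s0.
have : led K1 (sg + sg + de) (c * c * e).
  by rewrite -psv1 -sE expr2 !psvM; do 2?apply: led_mul.
move=> hK; have cce : c * c * e != 0 by rewrite !mulf_neq0.
have [sgE cE] := led_nz_uniq hK (led_const 1) cce (oner_neq0 _).
exists c; split; first by rewrite expr2.
have hsA : ledm (Kscale s' (kmx A)) (sg + ga) (c *: M).
  by move=> i j; rewrite !mxE; apply: led_mul => //; have := hA i j; rewrite mxE.
have cM0 : c *: M != 0 by rewrite scaler_eq0 negb_or c0.
have [-> ->] := lead_uniq hsA cM0.
have -> : sg + ga = ga - de / 2 by lra.
by rewrite cexpN.
Qed.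

Lemma mdet_lead A ga M de e : ledm A ga M -> led (Kdet A) de e -> e != 0 ->
  [/\ de <= ga *+ 2, de != ga *+ 2 -> mdet M = 0 & de = ga *+ 2 -> mdet M = e].
Proof.
move=> /ledm_det hA hd e0; rewrite mulr2n.
have [lt|gt|E] := ltgtP de (ga + ga).
- split=> // [_|E]; last by move: lt; rewrite E ltxx.
  exact: led_uniq hA (led_weak hd lt).
- by case/eqP: e0; rewrite -(proj2 hd) (proj1 hA).
- split=> // _; apply: (led_uniq hA); by rewrite -E.
Qed.

Lemma mdet_null A ga M : ledm A ga M -> Kdet A = K0 -> mdet M = 0.
Proof. by move=> /ledm_det + dA; rewrite dA => /led_uniq; apply; exact: led0. Qed.

Lemma polar_mdet al N : 0 <= al -> N != 0 -> (al != 0 -> mdet N = 0) ->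
  (al = 0 -> mdet N = 1) -> mdet (polar (cexp al) N) != 0.
Proof.
move=> al0; rewrite mx2_neq0 => nz D D'; rewrite /mdet.
case: (polarE (cexp al) N) => -> -> -> ->; apply: polar_det_neq0 => //.
- exact: cexp_ge1.
- move=> h; apply: D; apply: contraNneq h => ->; by rewrite cexp0.
- by move=> h; apply: D'; apply: cexp_inj; rewrite h cexp0.
Qed.

Lemma scale_norm (M : 'M[Cx]_2) s e (ga de : rat) : s ^+ 2 * e = 1 -> M != 0 -> de <= ga *+ 2 ->
  (de != ga *+ 2 -> mdet M = 0) -> (de = ga *+ 2 -> mdet M = e) ->
  [/\ s != 0, 0 <= ga - de / 2, s *: M != 0, ga - de / 2 != 0 -> mdet (s *: M) = 0 &
      ga - de / 2 = 0 -> mdet (s *: M) = 1].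
Proof.
move=> sE M0 h1 h2 h3; have s0 : s != 0.
  by apply: contra_eq_neq sE => ->; rewrite expr0n mul0r eq_sym oner_neq0.
rewrite mdetZ; split=> //; first by move: h1; rewrite mulr2n; lra.
- by rewrite scaler_eq0 negb_or s0.
- by move=> h; rewrite h2 ?mulr0 //; apply: contraNneq h => ->; rewrite mulr2n; apply/eqP; field.
- by move=> h; rewrite h3 // mulr2n; lra.
Qed.

Lemma ledm_ex (A : 'M[pser]_2) : A != 0 -> exists ga M, M != 0 /\ ledm (kmx A) ga M.
Proof.
move=> A0.
have hex : exists ij : 'I_2 * 'I_2, A ij.1 ij.2 != 0.
  apply: contrapT => /forallNP h; case/eqP: A0; apply/matrixP => i j; rewrite mxE.
  by apply/eqP/negPn/negP; exact: (h (i, j)).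
have /choice[g hg] : forall ij : 'I_2 * 'I_2, exists ec : rat * Cx, A ij.1 ij.2 != 0 ->
    ec.2 != 0 /\ led (A ij.1 ij.2) ec.1 ec.2.
  move=> ij; have [->|h] := eqVneq (A ij.1 ij.2) 0; first by exists (0, 0).
  by have [e [c [c0 hc]]] := pser_led h; exists (e, c).
have [ij0 hij0] := hex.
pose ij1 := [arg max_(ij > ij0 | A ij.1 ij.2 != 0) (g ij).1]%O.
have [hij1 hmax] : A ij1.1 ij1.2 != 0 /\ forall ij, A ij.1 ij.2 != 0 -> (g ij).1 <= (g ij1).1.
  by rewrite /ij1; case: arg_maxP.
exists (g ij1).1, (\matrix_(i, j) psv (A i j) (g ij1).1); split.
  apply/eqP => /matrixP /(_ ij1.1 ij1.2); rewrite !mxE => h.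
  by have [/eqP nz [_ E]] := hg _ hij1; apply: nz; rewrite -E.
move=> i j; rewrite !mxE; split=> // q hq.
have [->|nz] := eqVneq (A i j) 0; first by [].
have [_ [h _]] := hg (i, j) nz; apply: h; apply: le_lt_trans hq; exact: (hmax (i, j)).
Qed.

(** * Conditions on a point whose VAL is attained on the surface *)

Section Transfer.
Variables (d : nat) (f : 'I_(d./2).+1 -> {mpoly Cx[4]}).
Notation n := (d./2).
Notation dg j := (2 * j + odd d)%N.
Hypothesis hf : forall j : 'I_n.+1, homog_deg (dg j) (f j).

Definition covered (C : 'M[pser]_2) :=
  exists D, in_surface f D /\ proj_eq (VALrep (kmx C)) (VALrep D).

Lemma surface_lead D : in_surface f D -> exists D' ga M, [/\ D = kmx D', M != 0,
  ledm D ga M & surfF f D = K0].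
Proof.
move=> [/puiseux_kmx[D' ->] [[i [j hij]] hS]].
have [|ga [M [M0 hM]]] := @ledm_ex D'; last by exists D', ga, M.
by apply: contra_notN hij => /eqP->; rewrite !mxE.
Qed.

(** The value of [C] is singular, so the surface point with the same value has determinant 0 too, by
    [polar_mdet]; then [surf_null] applies. *)
Lemma covered_null C ga M : covered C -> ledm (kmx C) ga M -> M != 0 ->
  mdet C = 0 -> gval f ord_max M = 0.
Proof.
move=> [D [/surface_lead[D' [gD [MD [-> MD0 hD hS]]]] [z [z0 VE]]]] hC M0 dC.
have dC' : Kdet (kmx C) = K0 by rewrite kmx_det dC.
move: VE; rewrite (VALrep_null hC M0 dC').
have [dD|dD] := eqVneq (mdet D') 0.
  have dD' : Kdet (kmx D') = K0 by rewrite kmx_det dD.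
  rewrite (VALrep_null hD MD0 dD') => /(gval_scale hf ord_max)->.
  by rewrite (surf_null hf hD dD' hS) mulr0.
have [de [e [e0 hde]]] := pser_led dD; rewrite -kmx_det in hde.
have [s [sE ->]] := VALrep_nz hD MD0 hde e0.
have [h1 h2 h3] := mdet_lead hD hde e0.
have [s0 al0 sM D0 D1] := scale_norm sE MD0 h1 h2 h3.
move=> ME; have := polar_mdet al0 sM D0 D1.
have := mdet_null hC dC'; rewrite ME mdetZ => /eqP.
by rewrite mulf_eq0 expf_eq0 (negPf z0) /= => ->.
Qed.

(** The positive level makes [polar_inj] applicable: VAL determines the level, and the normalized
    leading matrix up to the real factor [z]. *)
Lemma covered_nz C ga M de e : covered C -> ledm (kmx C) ga M -> M != 0 ->
  led (mdet C) de e -> e != 0 -> 0 < ga - de / 2 ->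
  exists D gD MD dD eD k z, [/\ ledm D gD MD, led (Kdet D) dD eD, eD != 0,
    surfF f D = K0 & [/\ gD - dD / 2 = ga - de / 2, M = k *: MD, k ^+ 2 = z ^+ 2 * e / eD,
       z != 0 & z^* = z]].
Proof.
move=> [D [/surface_lead[D' [gD [MD [-> MD0 hD hS]]]] [z [z0 VE]]]] hC M0 hde e0 al0.
rewrite -kmx_det in hde.
move: VE; have [s [sE ->]] := VALrep_nz hC M0 hde e0.
have [h1 h2 h3] := mdet_lead hC hde e0.
have [s0 _ sM D0 D1] := scale_norm sE M0 h1 h2 h3.
have [dD|dD] := eqVneq (mdet D') 0.
  have dD' : Kdet (kmx D') = K0 by rewrite kmx_det dD.
  rewrite (VALrep_null hD MD0 dD') => E.
  have := polar_mdet (ltW al0) sM D0 D1.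
  by rewrite E mdetZ (mdet_null hD dD') mulr0 eqxx.
have [dD' [eD [eD0 hdD]]] := pser_led dD; rewrite -kmx_det in hdD.
have [s' [s'E ->]] := VALrep_nz hD MD0 hdD eD0.
have [h1' h2' h3'] := mdet_lead hD hdD eD0.
have [s'0 al0' sM' D0' D1'] := scale_norm s'E MD0 h1' h2' h3'.
move=> E.
have Eij i j : polar (cexp (ga - de / 2)) (s *: M) i j =
   z * polar (cexp (gD - dD' / 2)) (s' *: MD) i j by rewrite E mxE.
have [p00 p01 p10 p11] := polarE (cexp (ga - de / 2)) (s *: M).
have [q00 q01 q10 q11] := polarE (cexp (gD - dD' / 2)) (s' *: MD).
have [] := @polar_inj Cx (cexp (ga - de / 2)) (cexp (gD - dD' / 2))
   ((s *: M) i0 i0) ((s *: M) i0 i1) ((s *: M) i1 i0) ((s *: M) i1 i1)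
   ((s' *: MD) i0 i0) ((s' *: MD) i0 i1) ((s' *: MD) i1 i0) ((s' *: MD) i1 i1) z.
- exact: cexp_gt1.
- exact: cexp_ge1.
- by apply: D0; rewrite gt_eqF.
- by rewrite -mx2_neq0.
- by move=> h; apply: D0'; apply: contraNneq h => ->; rewrite cexp0.
- by move=> h; apply: D1'; apply: cexp_inj; rewrite h cexp0.
- exact: z0.
- by rewrite -p00 -q00.
- by rewrite -p01 -q01.
- by rewrite -p10 -q10.
- by rewrite -p11 -q11.
move=> /cexp_inj alE zR [e00 e01 e10 e11].
have ME : s *: M = (z * s') *: MD.
  by rewrite -scalerA; apply: mx2_eq; rewrite [RHS]mxE.
exists (kmx D'), gD, MD, dD', eD, (z * s' / s), z; split=> //; split=> //.
  by rewrite mulrC -scalerA -ME scalerA mulVf // scale1r.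
have -> : e = s ^- 2 by rewrite (mulr1_eq sE).
have -> : eD = s' ^- 2 by rewrite (mulr1_eq s'E).
by field; rewrite s0 s'0.
Qed.

Lemma covered_open C ga M de e (j : 'I_n.+1) : covered C -> ledm (kmx C) ga M ->
  M != 0 -> led (mdet C) de e -> e != 0 -> 0 < ga - de / 2 ->
  (j == 0%N :> nat) || (j%:R < ga - de / 2) ->
  (j == n :> nat) || (ga - de / 2 < j.+1%:R) -> gval f j M = 0.
Proof.
move=> cC hC M0 hde e0 al0 hl hr.
have [D [gD [MD [dD [eD [k [z [hD hdD eD0 hS [alE ME _ _ _]]]]]]]]] :=
  covered_nz cC hC M0 hde e0 al0.
rewrite (gval_scale hf j ME) (surf_open hf hD hdD hS (j := j)) ?mulr0 ?alE //.
by rewrite eD0.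
Qed.

(** The degrees of the two forms differ by 2, so passing from the surface point to [C] multiplies
    the relation of [surf_wall] by [k ^ 2 * eD = z ^ 2 * e], and [rho = z ^ 2]. *)
Lemma covered_wall C ga M de e (i j : 'I_n.+1) : covered C -> ledm (kmx C) ga M ->
  M != 0 -> led (mdet C) de e -> e != 0 -> j = i.+1 :> nat -> ga - de / 2 = j%:R ->
  exists rho : Cx, 0 < rho /\ gval f j M = - (rho * e * gval f i M).
Proof.
move=> cC hC M0 hde e0 ji al; have al0 : 0 < ga - de / 2 by rewrite al ji ltr0n.
have [D [gD [MD [dD [eD [k [z [hD hdD eD0 hS [alE ME kE z0 zR]]]]]]]]] :=
  covered_nz cC hC M0 hde e0 al0.
exists (z ^+ 2); split; first by rewrite expr2 -{2}zR mul_conjC_gt0.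
rewrite !(gval_scale hf _ ME) (surf_wall hf hD hdD hS eD0 ji); last by rewrite alE.
have -> : (dg j = 2 + dg i)%N by rewrite ji; lia.
by rewrite exprD kE; field.
Qed.

End Transfer.

(** * The reduction of a line *)

(** The symmetric bilinear form obtained by polarizing [mdet]. *)
Definition mpol (R : pzRingType) (A B : 'M[R]_2) : R :=
  A i0 i0 * B i1 i1 + A i1 i1 * B i0 i0 - A i0 i1 * B i1 i0 - A i1 i0 * B i0 i1.

Lemma mdet_comb (R : comPzRingType) (x y : R) (A B : 'M[R]_2) :
  mdet (x *: A + y *: B) = x ^+ 2 * mdet A + x * y * mpol A B + y ^+ 2 * mdet B.
Proof. rewrite /mdet /mpol !mxE; ring. Qed.

Lemma pser_two_neq0 : (2 : pser) != 0.
Proof.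
apply/eqP => /(congr1 (fun x => psv x 0)); rewrite psvD /Kadd psv1 /K1 /Kconst eqxx.
by move/eqP; rewrite (pnatr_eq0 Cx 2).
Qed.

Lemma led_pconst c : led (pconst c) 0 c.
Proof. exact: led_const. Qed.

Lemma led_pt e : led (pt e) e 1.
Proof. exact: led_Kt. Qed.

Lemma led_shift (x : pser) e e' c : led x e c -> led (pt e' * x) (e' + e) c.
Proof. by move=> h; rewrite -[c]mul1r; apply: led_mul => //; exact: led_pt. Qed.

Lemma ledm_shift A e e' M : ledm (kmx A) e M -> ledm (kmx (pt e' *: A)) (e' + e) M.
Proof. by move=> h i j; have := h i j; rewrite !mxE; apply: led_shift. Qed.

Lemma ledm_comb A B (x y : pser) e a b M N :
  ledm (kmx A) 0 M -> ledm (kmx B) 0 N -> led x e a -> led y e b ->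
  ledm (kmx (x *: A + y *: B)) e (a *: M + b *: N).
Proof.
move=> hA hB hx hy i j; have := hA i j; have := hB i j; rewrite !mxE => h1 h2.
by rewrite -[e]addr0; apply: led_add; apply: led_mul.
Qed.

Lemma pt_neq0 e : pt e != 0.
Proof.
apply/eqP => /(congr1 (fun x => psv x e)); rewrite /= /Kt eqxx /K0 => /eqP.
by rewrite oner_eq0.
Qed.

Section Line.
Variables (d : nat) (f : 'I_(d./2).+1 -> {mpoly Cx[4]}).
Notation n := (d./2).
Notation dg j := (2 * j + odd d)%N.
Hypothesis d3 : (3 < d)%N.
Hypothesis hf : forall j : 'I_n.+1, homog_deg (dg j) (f j).

Definition covline (A B : 'M[pser]_2) := forall l m : pser, (l != 0) || (m != 0) ->
  l *: A + m *: B != 0 /\ covered f (l *: A + m *: B).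

Lemma covline_change A B (p q r s : pser) : covline A B -> p * s - q * r != 0 ->
  covline (p *: A + q *: B) (r *: A + s *: B).
Proof.
move=> h D l m lm.
have -> : l *: (p *: A + q *: B) + m *: (r *: A + s *: B) =
   (l * p + m * r) *: A + (l * q + m * s) *: B.
  by apply/matrixP => i j; rewrite !mxE; ring.
apply: h; apply: contraTT lm; rewrite !negb_or !negbK => /andP[/eqP e1 /eqP e2].
have l0 : l * (p * s - q * r) = 0.
  have -> : l * (p * s - q * r) = (l * p + m * r) * s - (l * q + m * s) * r by ring.
  by rewrite e1 e2 !mul0r subrr.
have m0 : m * (p * s - q * r) = 0.
  have -> : m * (p * s - q * r) = (l * q + m * s) * p - (l * p + m * r) * q by ring.
  by rewrite e1 e2 !mul0r subrr.
move/eqP: l0; move/eqP: m0; rewrite !mulf_eq0 (negPf D) !orbF => -> ->//.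
Qed.

(** Puiseux series have square roots, so the quadratic formula yields a point of the line on the
    quadric. *)
Lemma covline_null A B : covline A B -> exists A' B', covline A' B' /\ mdet A' = 0.
Proof.
move=> h; have [a0|a0] := eqVneq (mdet A) 0; first by exists A, B.
have [s sE] := pser_sqrt (mpol A B ^+ 2 - 2 * 2 * mdet A * mdet B).
pose x := (s - mpol A B) / (2 * mdet A).
exists (x *: A + 1 *: B), (1 *: A + 0 *: B); split.
  by apply: covline_change => //; rewrite mulr0 mul1r sub0r oppr_eq0 oner_neq0.
have n2 := pser_two_neq0.
have n4 : (4 : pser) != 0.
  by have -> : (4 : pser) = 2 * 2; [ring | rewrite mulf_neq0].
rewrite mdet_comb; have -> : x ^+ 2 * mdet A + x * 1 * mpol A B + 1 ^+ 2 * mdet B =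
   (s ^+ 2 - (mpol A B ^+ 2 - 2 * 2 * mdet A * mdet B)) / (2 * 2 * mdet A).
  by rewrite /x; field; rewrite a0 n4 n2.
by rewrite sE subrr mul0r.
Qed.

(** Gaussian elimination over the valuation ring: an entry that is nonzero in the reduction of the
    first basis point is cleared in the second, which makes the reductions independent. *)
Lemma covline_reduce A B : covline A B -> exists A0 A1 (B0 B1 : 'M[Cx]_2),
  [/\ covline A0 A1, mdet A0 = 0, ledm (kmx A0) 0 B0, ledm (kmx A1) 0 B1 &
    forall x y : Cx, x *: B0 + y *: B1 = 0 -> x = 0 /\ y = 0].
Proof.
move=> /covline_null[{}A [{}B [h dA]]].
have A0 : A != 0.
  by have [] := h 1 0; rewrite ?oner_neq0 // scale1r scale0r addr0.
have [ga [M [M0 hM]]] := ledm_ex A0.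
pose A' := pt (- ga) *: A.
have hA' : ledm (kmx A') 0 M by rewrite -[0](addNr ga); exact: ledm_shift.
have [i [j Mij]] : exists i j, M i j != 0.
  by move: M0; rewrite mx2_neq0 => /or4P[]; do 2?eexists; eauto.
have Aij : A' i j != 0.
  apply: contra_neq Mij => A0ij; have := hA' i j; rewrite mxE A0ij => /led_uniq; apply.
  exact: led0.
pose r := - (B i j / A' i j) * pt (- ga).
have h' : covline (pt (- ga) *: A + 0 *: B) (r *: A + 1 *: B).
  by apply: covline_change => //; rewrite mulr1 mul0r subr0 pt_neq0.
rewrite scale0r addr0 scale1r -/A' in h'.
have B'0 : r *: A + B != 0.
  by have [] := h' 0 1; rewrite ?oner_neq0 ?orbT // scale1r scale0r add0r.
have B'ij : (r *: A + B) i j = 0.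
  have -> : r *: A + B = - (B i j / A' i j) *: A' + B by rewrite scalerA.
  by rewrite [LHS]mxE [X in X + _]mxE mulNr divfK // addNr.
have [gb [N [N0 hN]]] := ledm_ex B'0.
exists A', (pt (- gb) *: (r *: A + B)), M, N; split.
- have := @covline_change _ _ 1 0 0 (pt (- gb)) h'.
  rewrite !scale1r !scale0r addr0 add0r; apply.
  by rewrite mul1r mul0r subr0 pt_neq0.
- by rewrite mdetZ dA mulr0.
- exact: hA'.
- by rewrite -[0](addNr gb); exact: ledm_shift.
have Nij : N i j = 0.
  by have := hN i j; rewrite mxE B'ij => /led_uniq; apply; exact: led0.
move=> x y E; have := congr1 (fun X : 'M_2 => X i j) E; rewrite !mxE Nij mulr0 addr0.
move/eqP; rewrite mulf_eq0 (negPf Mij) orbF => /eqP x0; split=> //.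
move/eqP: E; rewrite x0 scale0r add0r scaler_eq0 (negPf N0) orbF => /eqP//.
Qed.

Lemma led_le (x : K) e e' c1 c2 : led x e c1 -> c1 != 0 -> led x e' c2 -> e <= e'.
Proof.
move=> h n0 h'; rewrite leNgt; apply/negP => lt; case/eqP: n0.
by rewrite -(proj2 h) (proj1 h').
Qed.

Section Reduced.
Variables (A0 A1 : 'M[pser]_2) (B0 B1 : 'M[Cx]_2).
Hypotheses (hcov : covline A0 A1) (dA0 : mdet A0 = 0).
Hypotheses (hB0 : ledm (kmx A0) 0 B0) (hB1 : ledm (kmx A1) 0 B1).
Hypothesis hfree : forall x y : Cx, x *: B0 + y *: B1 = 0 -> x = 0 /\ y = 0.

Lemma comb_neq0 (x y : Cx) : (x != 0) || (y != 0) -> x *: B0 + y *: B1 != 0.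
Proof.
by apply: contraTneq => /hfree[-> ->]; rewrite eqxx.
Qed.

Lemma led_neq0 (x : pser) e c : led x e c -> c != 0 -> x != 0.
Proof.
by move=> h; apply: contra_neq => x0; move: h; rewrite x0 => /led_uniq; apply; exact: led0.
Qed.

Lemma covered_comb (x y : pser) e (a b : Cx) : led x e a -> led y e b ->
  (a != 0) || (b != 0) ->
  [/\ covered f (x *: A0 + y *: A1), ledm (kmx (x *: A0 + y *: A1)) e (a *: B0 + b *: B1) &
     a *: B0 + b *: B1 != 0].
Proof.
move=> hx hy ab; split; last exact: comb_neq0.
  apply: (hcov _).2; case/orP: ab => h; apply/orP; [left|right].
    exact: led_neq0 hx h.
  exact: led_neq0 hy h.
exact: ledm_comb.
Qed.

Let b := mpol A0 A1.
Let c := mdet A1.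

Lemma mdet_line x y : mdet (x *: A0 + y *: A1) = y * (b * x + c * y).
Proof. rewrite mdet_comb dA0 /b /c; ring. Qed.

Lemma gn_B0 : gval f ord_max B0 = 0.
Proof.
have [|h1 h2 h3] := @covered_comb (pconst 1) 0 0 1 0 (led_pconst 1) (led0 0).
  by rewrite oner_neq0.
have dz : mdet (pconst 1 *: A0 + 0 *: A1) = 0 by rewrite mdet_line mul0r.
by have := covered_null hf h1 h2 h3 dz; rewrite scale1r scale0r addr0.
Qed.

Lemma mdet_B0 : mdet B0 = 0.
Proof. by apply: (mdet_null hB0); rewrite kmx_det dA0. Qed.

Lemma gn_null (x y : Cx) : b = 0 -> c = 0 -> (x != 0) || (y != 0) ->
  gval f ord_max (x *: B0 + y *: B1) = 0.
Proof.
move=> b0 c0 xy.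
have [h1 h2 h3] := covered_comb (led_pconst x) (led_pconst y) xy.
by apply: (covered_null hf h1 h2 h3); rewrite mdet_line b0 c0 !mul0r addr0 mulr0.
Qed.

Lemma led_b : led b 0 (mpol B0 B1).
Proof.
have h i j := hB0 i j; have h' i j := hB1 i j.
rewrite /b /mpol !(psvD, psvN, psvM) -[0]addr0.
by do 3?[apply: led_add]; rewrite ?(psvN, psvM); do ?[apply: led_opp]; apply: led_mul;
   [have := h i0 i0|have := h' i1 i1|have := h i1 i1|have := h' i0 i0|have := h i0 i1
   |have := h' i1 i0|have := h i1 i0|have := h' i0 i1]; rewrite mxE.
Qed.

Lemma led_c : led c 0 (mdet B1).
Proof. by have := ledm_det hB1; rewrite addr0 kmx_det. Qed.

Lemma bc_lead : (b != 0) || (c != 0) -> exists mu b0 c0,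
  [/\ mu <= 0, led b mu b0, led c mu c0 & (b0 != 0) || (c0 != 0)].
Proof.
have [b0|bn] := eqVneq b 0; have [c0|cn] := eqVneq c 0 => // _.
- have [e [k [k0 hk]]] := pser_led cn; exists e, 0, k; rewrite b0 k0 orbT; split=> //.
  exact: led_le hk k0 led_c.
- have [e [k [k0 hk]]] := pser_led bn; exists e, k, 0; rewrite c0 k0; split=> //.
  exact: led_le hk k0 led_b.
have [e [k [k0 hk]]] := pser_led bn; have [e' [k' [k0' hk']]] := pser_led cn.
have he := led_le hk k0 led_b; have he' := led_le hk' k0' led_c.
have [lt|gt|E] := ltgtP e e'.
- by exists e', 0, k'; rewrite k0' orbT; split=> //; exact: led_weak hk lt.
- by exists e, k, 0; rewrite k0; split=> //; exact: led_weak hk' gt.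
- by exists e, k, k'; rewrite k0; split=> //; rewrite E.
Qed.

Section Lead.
Variables (mu : rat) (b0 c0 : Cx).
Hypotheses (mu0 : mu <= 0) (hb : led b mu b0) (hc : led c mu c0).
Hypothesis bc0 : (b0 != 0) || (c0 != 0).

Lemma led_mdet_line (x y : Cx) :
  led (mdet (pconst x *: A0 + pconst y *: A1)) mu (y * (b0 * x + c0 * y)).
Proof.
rewrite mdet_line psvM psvD !psvM -[mu]add0r; apply: led_mul; first exact: led_pconst.
by rewrite -[mu]addr0; apply: led_add; apply: led_mul => //; exact: led_pconst.
Qed.

Lemma line_open (j : 'I_n.+1) (x y : Cx) : 0 < - (mu / 2) -> j%:R < - (mu / 2) ->
  (j == n :> nat) || (- (mu / 2) < j.+1%:R) -> y * (b0 * x + c0 * y) != 0 ->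
  gval f j (x *: B0 + y *: B1) = 0.
Proof.
move=> al0 hl hr q0.
have xy : (x != 0) || (y != 0).
  by apply/orP; right; apply: contraNneq q0 => ->; rewrite mul0r.
have [h1 h2 h3] := covered_comb (led_pconst x) (led_pconst y) xy.
by apply: (covered_open hf h1 h2 h3 (led_mdet_line x y) q0); rewrite ?sub0r ?hl ?orbT.
Qed.

Lemma line_wall (i j : 'I_n.+1) (x y : Cx) : j = i.+1 :> nat -> - (mu / 2) = j%:R ->
  y * (b0 * x + c0 * y) != 0 -> exists rho : Cx, 0 < rho /\
    gval f j (x *: B0 + y *: B1) =
    - (rho * (y * (b0 * x + c0 * y)) * gval f i (x *: B0 + y *: B1)).
Proof.
move=> ji al q0.
have xy : (x != 0) || (y != 0).
  by apply/orP; right; apply: contraNneq q0 => ->; rewrite mul0r.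
have [h1 h2 h3] := covered_comb (led_pconst x) (led_pconst y) xy.
by apply: (covered_wall hf h1 h2 h3 (led_mdet_line x y) q0 ji); rewrite sub0r.
Qed.

(** Besides [A0], the form [y * (b * x + c * y)] vanishes at [(c, - b)], and that point reduces to
    this matrix. *)
Lemma second_root : gval f ord_max (c0 *: B0 - b0 *: B1) = 0.
Proof.
have hN : led (- b) mu (- b0) by exact: led_opp.
have [|h1 h2 h3] := covered_comb hc hN; first by rewrite oppr_eq0 orbC.
have dz : mdet (c *: A0 + (- b) *: A1) = 0.
  by rewrite mdet_line; ring.
by have := covered_null hf h1 h2 h3 dz; rewrite scaleNr.
Qed.

(* Points [A0 +- t^(-e) A1] of the line realize every level above [- mu / 2]. *)
Lemma near_B0 (T : rat) (j : 'I_n.+1) : - mu < T ->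
  (j == 0%N :> nat) || (j%:R < T / 2) -> (j == n :> nat) || (T / 2 < j.+1%:R) ->
  gval f j B0 = 0.
Proof.
move=> hT hl hr.
(* At [y = z * t ^ (- e)] the determinant is [y * (b + c * y)]; these conditions give it the leading
   term [z * (be + ga * z) * t ^ (- T)]. *)
suff [e [z [be [ga [e0 hb' hc' q0]]]]] : exists e z (be ga : Cx), [/\ 0 < e,
    led b (e - T) be, led c (2 * e - T) ga & z * (be + ga * z) != 0].
  have hy : led (pt (- e) * pconst z) (- e) z.
    by have := led_shift (- e) (led_pconst z); rewrite addr0.
  have hy0 : led (pt (- e) * pconst z) 0 0 by apply: led_weak hy _; rewrite oppr_lt0.
  have [|h1 h2 h3] := covered_comb (led_pconst 1) hy0; first by rewrite oner_neq0.
  have hd : led (mdet (pconst 1 *: A0 + (pt (- e) * pconst z) *: A1)) (- T) (z * (be + ga * z)).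
    rewrite mdet_line psvM; have -> : - T = - e + (e - T) by ring.
    apply: led_mul => //; rewrite psvD; apply: led_add.
      by rewrite mulr1.
    by have := led_mul hc' hy; have -> : 2 * e - T + - e = e - T by ring.
  have := covered_open hf (j := j) h1 h2 h3 hd q0.
  have -> : 0 - - T / 2 = T / 2 by field.
  have T0 : 0 < T / 2 by have := mu0; lra.
  by rewrite scale1r scale0r addr0; apply.
(* One of [z = 1] and [z = -1] works, since [be + ga] and [be - ga] cannot both vanish. *)
have sel (be ga : Cx) : (be != 0) || (ga != 0) -> exists z, z * (be + ga * z) != 0.
  move=> h; have [E|] := eqVneq (1 * (be + ga * 1)) 0; last by exists 1.
  exists (-1); rewrite mulN1r oppr_eq0 mulrN1; apply: contraTneq h => E'.
  have ga0 : ga = 0.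
    have : (1 * (be + ga * 1) - (be - ga)) = 2 * ga by ring.
    rewrite E E' subrr => /esym/eqP; rewrite mulf_eq0 pnatr_eq0 /= => /eqP//.
  by move: E'; rewrite ga0 subr0 => ->; rewrite eqxx.
have [bz|bn] := eqVneq b 0.
  have cn : c0 != 0.
    by move: bc0; rewrite (led_uniq hb (c' := 0)) ?eqxx // bz; exact: led0.
  have [z hz] := sel 0 c0 (introT orP (or_intror cn)).
  exists ((mu + T) / 2), z, 0, c0; split=> //; try lra.
  - by rewrite bz; exact: led0.
  - by have -> : 2 * ((mu + T) / 2) - T = mu by field.
have [eb [kb [kb0 hkb]]] := pser_led bn.
have leb : eb <= mu by exact: led_le hkb kb0 hb.
have [cz|cn] := eqVneq c 0.
  have b0n : b0 != 0.
    by move: bc0; rewrite orbC (led_uniq hc (c' := 0)) ?eqxx // cz; exact: led0.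
  have [E _] := led_nz_uniq hkb hb kb0 b0n.
  have [z hz] := sel kb 0 (introT orP (or_introl kb0)).
  exists (eb + T), z, kb, 0; split=> //; try lra.
  - by have -> : eb + T - T = eb by ring.
  - by rewrite cz; exact: led0.
have [ec [kc [kc0 hkc]]] := pser_led cn.
have lec : ec <= mu by exact: led_le hkc kc0 hc.
have hmax : (eb == mu) || (ec == mu).
  case/orP: bc0 => h; apply/orP; [left|right].
    by have [->] := led_nz_uniq hkb hb kb0 h.
  by have [->] := led_nz_uniq hkc hc kc0 h.
(* Newton polygon: [e] is the larger of the two numbers. It is positive because [eb] or [ec] equals
   [mu > - T]. *)
have [lt|gt|E] := ltgtP (eb + T) ((ec + T) / 2).
- have [z hz] := sel 0 kc (introT orP (or_intror kc0)).
  exists ((ec + T) / 2), z, 0, kc; split=> //.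
  + by case/orP: hmax => /eqP; lra.
  + by apply: led_weak hkb _; lra.
  + by have -> : 2 * ((ec + T) / 2) - T = ec by field.
- have [z hz] := sel kb 0 (introT orP (or_introl kb0)).
  exists (eb + T), z, kb, 0; split=> //.
  + by case/orP: hmax => /eqP; lra.
  + by have -> : eb + T - T = eb by ring.
  + by apply: led_weak hkc _; lra.
have [z hz] := sel kb kc (introT orP (or_introl kb0)).
exists (eb + T), z, kb, kc; split=> //.
+ by case/orP: hmax => /eqP; lra.
+ by have -> : eb + T - T = eb by ring.
+ by have -> : 2 * (eb + T) - T = ec by rewrite E; field.
Qed.

End Lead.

Definition null_pencil := [/\ mdet B0 = 0, mdet B1 = 0 & mpol B0 B1 = 0].

(** The alternatives follow the level [- mu / 2]: below 1; at least 1 and off the walls, or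
    infinite; an integer between 1 and [n]. *)
Lemma line_cases :
  (mdet B0 = 0 /\ [/\ gval f ord0 B0 = 0, gval f (one d) B0 = 0 & gval f ord_max B0 = 0]) \/
  (null_pencil /\ exists (j : 'I_n.+1) (p q : Cx), [/\ (0 < j)%N, (p != 0) || (q != 0) &
    forall x y : Cx, y * (p * x + q * y) != 0 -> gval f j (x *: B0 + y *: B1) = 0]) \/
  (null_pencil /\ exists (i j : 'I_n.+1) (p q : Cx),
    [/\ j = i.+1 :> nat, (p != 0) || (q != 0),
      forall x y : Cx, y * (p * x + q * y) != 0 -> exists rho : Cx, 0 < rho /\
       gval f j (x *: B0 + y *: B1) =
       - (rho * (y * (p * x + q * y)) * gval f i (x *: B0 + y *: B1)),
      gval f ord_max B0 = 0 & gval f ord_max (q *: B0 - p *: B1) = 0]).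
Proof.
have n1 := n_gt1 d3; have v1 := val_one d3.
have [bc|] := boolP ((b != 0) || (c != 0)); last first.
  rewrite negb_or !negbK => /andP[/eqP bz /eqP cz]; right; left; split.
    split; first exact: mdet_B0.
    - by have := led_c; rewrite cz => /led_uniq; apply; exact: led0.
    - by have := led_b; rewrite bz => /led_uniq; apply; exact: led0.
  (* The whole line has determinant 0; with [p = 0] and [q = 1] the excluded locus is just
     [y = 0]. *)
  exists ord_max, 0, 1; split=> /=; [lia|by rewrite oner_neq0 orbT|].
  move=> x y; rewrite mul0r add0r mul1r mulf_eq0 orbb => y0.
  by apply: gn_null => //; rewrite y0 orbT.
have [mu [b0 [c0 [mu0 hb hc bc0]]]] := bc_lead bc.
have [lt|ge] := ltP (- (mu / 2)) 1.
  left; split; first exact: mdet_B0.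
  split; last exact: gn_B0.
  (* The level [T / 2] is the midpoint of [- mu / 2] and 1; the next case uses the level 3/2. *)
  - by apply: (near_B0 mu0 hb hc bc0 (T := 1 - mu / 2)) => //=; [lra|apply/orP; right; lra].
  - by apply: (near_B0 mu0 hb hc bc0 (T := 3)); rewrite ?v1; [lra|apply/orP; right; lra..].
right.
have hnull : null_pencil.
  have mun : mu < 0 by lra.
  split; first exact: mdet_B0.
  - by apply: (led_uniq led_c); exact: led_weak hc mun.
  - by apply: (led_uniq led_b); exact: led_weak hb mun.
(* The dominant index is the integer part of the level, capped at [n]. *)
have := truncn_itv (le_trans ler01 ge); set k := Num.trunc _ => /andP[k1 k2].
have k_gt0 : (0 < k)%N.
  by rewrite -ltnS -(ltr_nat rat); apply: le_lt_trans k2.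
have hj : (minn k n < n.+1)%N by rewrite ltnS geq_minr.
pose j := Ordinal hj.
have j_gt0 : (0 < j)%N by rewrite /= leq_min k_gt0 (ltnW n1).
have jle : j%:R <= - (mu / 2).
  by apply: le_trans k1; rewrite ler_nat geq_minl.
have [E|ne] := eqVneq (- (mu / 2)) j%:R; [right|left]; split=> //.
  have hi : (j.-1 < n.+1)%N by exact: leq_ltn_trans (leq_pred _) (ltn_ord j).
  have ji : j = (Ordinal hi).+1 :> nat by rewrite /= prednK.
  exists (Ordinal hi), j, b0, c0; split.
  - exact: ji.
  - exact: bc0.
  - by move=> x y q0; apply: (line_wall hb hc ji E q0).
  - exact: gn_B0.
  - exact: (second_root hb hc bc0).
exists j, b0, c0; split=> // x y q0.
apply: (line_open hb hc) => //; first lra.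
  by rewrite lt_def ne.
rewrite /= /minn; case: ltnP => hk; apply/orP; [right|left] => //.
Qed.

End Reduced.
End Line.

(** * Lines contained in the quadric *)

(** Eliminating [d] and [d'] turns the second determinant into a product of two linear factors, one
    for each ruling of the quadric. *)
Lemma pencil_ruling (F : fieldType) (a b c d a' b' c' d' : F) : a != 0 ->
  a * d - b * c = 0 -> a' * d' - b' * c' = 0 ->
  a * d' + d * a' - b * c' - c * b' = 0 ->
  (exists x, [/\ c = x * a, d = x * b, c' = x * a' & d' = x * b']) \/
  (exists x, [/\ b = x * a, d = x * c, b' = x * a' & d' = x * c']).
Proof.
move=> a0 D D' P.
have dE : d = b * c / a by apply: (mulfI a0); rewrite mulrCA mulfV // mulr1; apply/eqP; rewrite -subr_eq0 D.
have d'E : d' = b / a * c' + c / a * b' - b * c / a ^+ 2 * a'.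
  by apply: (mulfI a0); apply/eqP; rewrite -subr_eq0 -P dE; apply/eqP; field.
have : (c' - c / a * a') * (b' - b / a * a') = 0.
  have -> : (c' - c / a * a') * (b' - b / a * a') = - (a' * d' - b' * c').
    by rewrite d'E; field.
  by rewrite D' oppr0.
move/eqP; rewrite mulf_eq0 => /orP[]; rewrite subr_eq0 => /eqP E; [left|right].
  exists (c / a); split=> //; first by rewrite divfK.
    by rewrite dE; field.
  by rewrite d'E E; field.
exists (b / a); split=> //; first by rewrite divfK.
  by rewrite dE; field.
by rewrite d'E E; field.
Qed.

Lemma mvec_inord (M : 'M[Cx]_2) : [/\ mvec M (inord 0) = M i0 i0,
  mvec M (inord 1) = M i0 i1, mvec M (inord 2) = M i1 i0 & mvec M (inord 3) = M i1 i1].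
Proof.
have e0 : inord 0 = i0 :> 'I_2 by apply: val_inj; rewrite /= inordK.
have e1 : inord 1 = i1 :> 'I_2 by apply: val_inj; rewrite /= inordK.
by split; rewrite /mvec /entry_of inordK //= ?e0 ?e1.
Qed.

Lemma ord4_ind (P : 'I_4 -> Prop) : P (inord 0) -> P (inord 1) -> P (inord 2) ->
  P (inord 3) -> forall i, P i.
Proof.
move=> h0 h1 h2 h3 i; rewrite -(inord_val i).
by case: i => [[|[|[|[|k]]]] hk].
Qed.

Lemma mvec_chart rc fl x v0 v1 (M : 'M[Cx]_2) :
  let p := fun i j => cpt rc fl x v0 v1 (inord (i.*2 + j)) in
  M i0 i0 = p 0%N 0%N -> M i0 i1 = p 0%N 1%N -> M i1 i0 = p 1%N 0%N ->
  M i1 i1 = p 1%N 1%N -> forall i, mvec M i = cpt rc fl x v0 v1 i.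
Proof.
move=> p h1 h2 h3 h4; have [e1 e2 e3 e4] := mvec_inord M.
by apply: ord4_ind; rewrite ?e1 ?e2 ?e3 ?e4.
Qed.

(** Row and column swaps move a nonzero entry of [B0] to the corner required by [pencil_ruling];
    [fl] ensures that the common ratio [x] is finite. *)
Lemma null_pencil_chart (B0 B1 : 'M[Cx]_2) : B0 != 0 -> null_pencil B0 B1 ->
  exists rc fl x w00 w01 w10 w11,
    (forall i, mvec B0 i = cpt rc fl x w00 w01 i) /\
    (forall i, mvec B1 i = cpt rc fl x w10 w11 i).
Proof.
move=> nz [D0 D1 P]; rewrite /mdet /mpol in D0 D1 P.
set a := B0 i0 i0; set b := B0 i0 i1; set c := B0 i1 i0; set dd := B0 i1 i1.
set a' := B1 i0 i0; set b' := B1 i0 i1; set c' := B1 i1 i0; set d' := B1 i1 i1.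
rewrite -/a -/b -/c -/dd -/a' -/b' -/c' -/d' in D0 D1 P.
suff : (exists x, [/\ c = x * a, dd = x * b, c' = x * a' & d' = x * b']) \/
       (exists x, [/\ a = x * c, b = x * dd, a' = x * c' & b' = x * d']) \/
       (exists x, [/\ b = x * a, dd = x * c, b' = x * a' & d' = x * c']) \/
       (exists x, [/\ a = x * b, c = x * dd, a' = x * b' & c' = x * d']).
  move=> [[x [h1 h2 h3 h4]]|[[x [h1 h2 h3 h4]]|[[x [h1 h2 h3 h4]]|[x [h1 h2 h3 h4]]]]];
  [exists true, false, x, a, b, a', b'|exists true, true, x, c, dd, c', d'
  |exists false, false, x, a, c, a', c'|exists false, true, x, b, dd, b', d'];
  by split; apply: mvec_chart; rewrite /cpt /chart inordK //= ?mul1r.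
move: nz; rewrite mx2_neq0 => /or4P[] nz.
- by have [h|h] := pencil_ruling nz D0 D1 P; [left|right; right; left].
- have D0' : b * c - a * dd = 0 by rewrite -[RHS]oppr0 -[in RHS]D0; ring.
  have D1' : b' * c' - a' * d' = 0 by rewrite -[RHS]oppr0 -[in RHS]D1; ring.
  have P' : b * c' + c * b' - a * d' - dd * a' = 0 by rewrite -[RHS]oppr0 -[in RHS]P; ring.
  have [[x [? ? ? ?]]|[x [? ? ? ?]]] := pencil_ruling nz D0' D1' P'.
    by left; exists x.
  by right; right; right; exists x.
- have D0' : c * b - dd * a = 0 by rewrite -[RHS]oppr0 -[in RHS]D0; ring.
  have D1' : c' * b' - d' * a' = 0 by rewrite -[RHS]oppr0 -[in RHS]D1; ring.
  have P' : c * b' + b * c' - dd * a' - a * d' = 0 by rewrite -[RHS]oppr0 -[in RHS]P; ring.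
  have [[x [? ? ? ?]]|[x [? ? ? ?]]] := pencil_ruling nz D0' D1' P'.
    by right; left; exists x.
  by right; right; left; exists x.
have D0' : dd * a - c * b = 0 by rewrite -[RHS]D0; ring.
have D1' : d' * a' - c' * b' = 0 by rewrite -[RHS]D1; ring.
have P' : dd * a' + a * d' - c * b' - b * c' = 0 by rewrite -[RHS]P; ring.
have [[x [? ? ? ?]]|[x [? ? ? ?]]] := pencil_ruling nz D0' D1' P'.
  by right; left; exists x.
by right; right; right; exists x.
Qed.

Lemma null_chart (B : 'M[Cx]_2) : B != 0 -> mdet B = 0 ->
  exists rc fl x v0 v1, ((v0 != 0) || (v1 != 0)) /\
    forall i, mvec B i = cpt rc fl x v0 v1 i.
Proof.
move=> nz D; have [|rc [fl [x [v0 [v1 [_ [_ [h _]]]]]]]] := @null_pencil_chart B 0 nz.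
  by split=> //; rewrite /mdet /mpol !mxE; ring.
exists rc, fl, x, v0, v1; split=> //; apply: contraTT nz.
rewrite negb_or !negbK => /andP[/eqP z0 /eqP z1].
have m0 i : mvec B i = 0 by rewrite h /cpt z0 z1 if_same mulr0.
have [e1 e2 e3 e4] := mvec_inord B.
by apply/eqP; apply: mx2_eq; rewrite mxE -?e1 -?e2 -?e3 -?e4.
Qed.

(** * Linear factors of binary forms and polynomials with real ratio *)

Definition lin (a b : Cx) : {poly Cx} := a%:P + b *: 'X.

Lemma size_lin a b : (size (lin a b) <= 2)%N.
Proof.
rewrite (leq_trans (size_polyD _ _)) // geq_max (leq_trans (size_polyC_leq1 _)) //=.
by rewrite (leq_trans (size_scale_leq _ _)) // size_polyX.
Qed.

Lemma lin_neq0 a b : (a != 0) || (b != 0) -> lin a b != 0.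
Proof.
apply: contraTneq => E; have := congr1 (fun p : {poly Cx} => p`_0) E.
have := congr1 (fun p : {poly Cx} => p`_1) E; rewrite /= /lin !coef0 !coefD !coefC !coefZ !coefX /=.
by rewrite mulr1 mulr0 addr0 add0r => -> ->; rewrite eqxx.
Qed.

Lemma hom_horner k (h : {poly Cx}) z : (size h <= k.+1)%N -> hom k h 1 z = h.[z].
Proof.
move=> hs; rewrite (horner_coef_wide _ hs); apply: eq_bigr => i _.
by rewrite expr1n mul1r.
Qed.

Lemma hom_lin k a b (r : {poly Cx}) v0 v1 : (size r <= k.+1)%N ->
  hom k.+1 (lin a b * r) v0 v1 = (a * v0 + b * v1) * hom k r v0 v1.
Proof.
move=> hs; have -> : lin a b * r = a *: r + b *: (r * 'X).
  by rewrite mulrDl mul_polyC -scalerAl (mulrC 'X).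
rewrite homD !homZ mulrDl -!mulrA; congr (a * _ + b * _).
  rewrite /hom big_ord_recr /= nth_default // mul0r addr0 mulr_sumr.
  apply: eq_bigr => i _; rewrite subSn ?exprS; last by rewrite -ltnS.
  by rewrite -!mulrA mulrCA.
rewrite /hom big_ord_recl coefMX /= mul0r add0r mulr_sumr.
apply: eq_bigr => i _; rewrite coefMX /= /bump /= add1n subSS exprS; ring.
Qed.

Lemma hom_root k a b (h : {poly Cx}) : (a != 0) || (b != 0) -> (size h <= k.+2)%N ->
  hom k.+1 h b (- a) = 0 -> exists r : {poly Cx}, (size r <= k.+1)%N /\ h = lin a b * r.
Proof.
(* For [b = 0] the root is at infinity: the top coefficient of [h] vanishes and [lin a b] is a
   nonzero constant. *)
move=> ab hs; have [b0|bn] := eqVneq b 0.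
  have a0 : a != 0 by move: ab; rewrite b0 eqxx orbF.
  rewrite b0 /hom big_ord_recr /= subnn expr0 mul1r big1 ?add0r => [|i _]; last first.
    by rewrite subSn ?exprS ?mul0r ?mulr0 // -ltnS.
  move/eqP; rewrite mulf_eq0 expf_eq0 oppr_eq0 (negPf a0) orbF => /eqP hk.
  exists (a^-1 *: h); split.
    apply: (leq_trans (size_scale_leq _ _)); apply/leq_sizeP => j.
    rewrite leq_eqVlt => /predU1P[<- //|]; exact: (leq_sizeP _ _ hs).
  by rewrite /lin scale0r addr0 mul_polyC scalerA mulfV // scale1r.
move=> hz.
have rt : root h (- a / b).
  rewrite /root (horner_coef_wide _ hs); apply/eqP; apply: (mulfI (expf_neq0 k.+1 bn)).
  rewrite mulr0 -[RHS]hz /hom mulr_sumr; apply: eq_bigr => i _.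
  have hi : (i <= k.+1)%N by rewrite -ltnS.
  rewrite expr_div_n -{1}(subnK hi) exprD; field; exact: expf_neq0.
have [r hr] := factor_theorem _ _ rt.
exists (b^-1 *: r); split.
  apply: (leq_trans (size_scale_leq _ _)).
  have [->|r0] := eqVneq r 0; first by rewrite size_poly0.
  by move: hs; rewrite hr size_Mmonic ?monicXsubC // size_XsubC addn2.
rewrite hr -scalerAr scalerAl [RHS]mulrC; congr (_ * _).
by rewrite /lin scalerDr scalerA mulVf // scale1r -mul_polyC -polyCM addrC mulNr polyCN opprK mulrC.
Qed.

Lemma poly_nat_eq0 (p : {poly Cx}) : (forall k : nat, p.[k%:R] = 0) -> p = 0.
Proof.
move=> h; apply: (@roots_geq_poly_eq0 _ p [seq k%:R | k <- iota 0 (size p)]).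
- by apply/allP => _ /mapP[k _ ->]; apply/eqP.
- by rewrite map_inj_uniq ?iota_uniq // => i j /eqP; rewrite eqr_nat => /eqP.
- by rewrite size_map size_iota.
Qed.

(* [P(z) conj(R(w)) - conj(P(w)) R(z)] is polynomial in [z] and [conj w], and
   vanishes for [w = z]; hence it vanishes identically. *)
Lemma real_ratio_const (P R : {poly Cx}) : R != 0 ->
  (forall z, P.[z] * (R.[z])^* = (P.[z])^* * R.[z]) -> exists la, P = la *: R.
Proof.
move=> R0 h; pose cj := map_poly (Num.conj : Cx -> Cx).
have cjE (p : {poly Cx}) z : (cj p).[z^*] = (p.[z])^* by rewrite /cj horner_map.
pose F z w := P.[z] * (cj R).[w] - (cj P).[w] * R.[z].
(* The hypothesis at the points [k + l * 'i]. First [k] and then [l] is freed, because a polynomial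
   vanishing at all naturals is zero. *)
have F1 (k l : nat) : F (k%:R + l%:R * 'i) (k%:R - l%:R * 'i) = 0.
  rewrite /F; have -> : k%:R - l%:R * 'i = (k%:R + l%:R * 'i)^* :> Cx.
    by rewrite rmorphD rmorphM /= !rmorph_nat [in RHS]conjCi mulrN.
  by rewrite !cjE h subrr.
have F2 (l : nat) a : F (a + l%:R * 'i) (a - l%:R * 'i) = 0.
  pose p := (P \Po ('X + (l%:R * 'i)%:P)) * (cj R \Po ('X - (l%:R * 'i)%:P)) -
    (cj P \Po ('X - (l%:R * 'i)%:P)) * (R \Po ('X + (l%:R * 'i)%:P)).
  have pE z : p.[z] = F (z + l%:R * 'i) (z - l%:R * 'i).
    by rewrite /p /F !hornerE !horner_comp !hornerE.
  by rewrite -pE (@poly_nat_eq0 p) ?horner0 // => k; rewrite pE F1.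
have F3 a b : F (a + b * 'i) (a - b * 'i) = 0.
  pose p := (P \Po (a%:P + 'i *: 'X)) * (cj R \Po (a%:P - 'i *: 'X)) -
    (cj P \Po (a%:P - 'i *: 'X)) * (R \Po (a%:P + 'i *: 'X)).
  have pE z : p.[z] = F (a + z * 'i) (a - z * 'i).
    by rewrite /p /F !hornerE !horner_comp !hornerE (mulrC 'i).
  by rewrite -pE (@poly_nat_eq0 p) ?horner0 // => k; rewrite pE F2.
have F4 z w : F z w = 0.
  have i0' : 'i != 0 :> Cx by rewrite neq0Ci.
  have n2 : 2 != 0 :> Cx by rewrite pnatr_eq0.
  have := F3 ((z + w) / 2) ((z - w) / (2 * 'i)).
  have -> : (z + w) / 2 + (z - w) / (2 * 'i) * 'i = z by field; rewrite ?i0' ?n2.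
  by have -> : (z + w) / 2 - (z - w) / (2 * 'i) * 'i = w by field; rewrite ?i0' ?n2.
have [w hw] : exists w, (cj R).[w] != 0.
  apply: contrapT => /forallNP hn; case/eqP: R0.
  have /eqP : cj R = 0 by apply: poly_nat_eq0 => k; apply/eqP/negPn/negP; exact: hn.
  by rewrite /cj map_poly_eq0 => /eqP.
exists ((cj P).[w] / (cj R).[w]); apply/eqP; rewrite -subr_eq0; apply/eqP.
apply: poly_nat_eq0 => k; rewrite !hornerE; apply: (mulIf hw).
by rewrite mul0r mulrBl mulrAC divfK // -[RHS](F4 k%:R w).
Qed.

(** * Generic surfaces contain no line *)

Section Contradiction.
Variables (d : nat) (f : 'I_(d./2).+1 -> {mpoly Cx[4]}).
Notation n := (d./2).
Notation dg j := (2 * j + odd d)%N.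
Hypothesis d3 : (3 < d)%N.
Hypothesis hf : forall j : 'I_n.+1, homog_deg (dg j) (f j).
Hypothesis generic : forall rc fl, ~ bad rc fl (coefs f).

Lemma gval_hom rc fl x v0 v1 j (M : 'M[Cx]_2) : (forall i, mvec M i = cpt rc fl x v0 v1 i) ->
  gval f j M = hom (dg j) (hz rc fl (coefs f) x j) v0 v1.
Proof. by move=> hM; rewrite -hz_eval //; apply: meval_eq. Qed.

Lemma restriction_neq0 rc fl x (j : 'I_n.+1) : (0 < dg j)%N -> hz rc fl (coefs f) x j != 0.
Proof.
move=> hj; apply/eqP => h; apply: (generic (rc := rc) (fl := fl)).
by left; exists j; split=> //; exists x.
Qed.

Lemma dg_max_gt1 : (1 < dg n)%N.
Proof. by have := n_gt1 d3; lia. Qed.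

(** For even [d], the form of index 0 is constant, so it would be 0, a multiple of [det]. For odd
    [d] it is linear, so on a line of the quadric through the common zero it divides the forms of
    indices 1 and [n]. *)
Lemma no_common_zero B0 : B0 != 0 -> mdet B0 = 0 -> ~ det_divides (f ord0) ->
  gval f ord0 B0 = 0 -> gval f (one d) B0 = 0 -> gval f ord_max B0 = 0 -> False.
Proof.
move=> nz D nd g0 g1 gn; have n1 := n_gt1 d3; have v1 := val_one d3.
case odd_d: (odd d); last first.
  apply: nd; exists 0; rewrite mulr0.
  have := hf ord0; rewrite odd_d muln0 => /allP h0.
  have fC : f ord0 = ((f ord0)@_0)%:MP.
    apply/mpolyP => m; rewrite mcoeffC; have [->|m0] := eqVneq m 0%MM; rewrite ?mulr1 // mulr0.
    apply/eqP; rewrite mcoeff_eq0; apply: contraNN m0 => /h0.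
    by rewrite mdeg_eq0.
  by move: g0; rewrite /gval fC mevalC => ->; rewrite mpolyC0.
have [rc [fl [x [v0 [v1' [vn hM]]]]]] := null_chart nz D.
have ab : (- v1' != 0) || (v0 != 0) by rewrite oppr_eq0 orbC.
have root (j : 'I_n.+1) k : dg j = k.+1 -> gval f j B0 = 0 ->
   exists r : {poly Cx}, (size r <= k.+1)%N /\ hz rc fl (coefs f) x j = lin (- v1') v0 * r.
  move=> jk; rewrite (gval_hom j hM) jk => h; apply: hom_root => //.
    by rewrite -jk; exact: size_hz.
  by rewrite opprK.
have [|r0 [s0 e0]] := root ord0 0%N _ g0; first by rewrite odd_d.
have [|r1 [s1 e1]] := root (one d) (dg (one d)).-1 _ g1; first by rewrite prednK // v1.
have [|rn [sn en]] := root ord_max (dg n).-1 _ gn; first by rewrite prednK //=; lia.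
have hn0 : hz rc fl (coefs f) x ord0 != 0 by apply: restriction_neq0; rewrite odd_d.
have r0E : r0 = (r0`_0)%:P by apply: size1_polyC.
have c0 : r0`_0 != 0.
  by apply: contraNneq hn0 => c0; rewrite e0 r0E c0 mulr0.
apply: (generic (rc := rc) (fl := fl)); do 4!right.
exists x, ((r0`_0)^-1 *: r1), ((r0`_0)^-1 *: rn); split.
- apply: (leq_trans (size_scale_leq _ _)); apply: leq_trans s1 _.
  by rewrite prednK // v1.
- apply: (leq_trans (size_scale_leq _ _)); apply: leq_trans sn _.
  by rewrite prednK //=; have := dg_max_gt1; lia.
- rewrite e0 e1 r0E -mulrA; congr (_ * _).
  by rewrite mul_polyC scalerA coefC eqxx mulfV // scale1r.
- rewrite e0 en r0E -mulrA; congr (_ * _).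
  by rewrite mul_polyC scalerA coefC eqxx mulfV // scale1r.
Qed.

Section Pencil.
Variables (B0 B1 : 'M[Cx]_2) (rc fl : bool) (x w00 w01 w10 w11 : Cx).
Hypothesis hfree : forall a b : Cx, a *: B0 + b *: B1 = 0 -> a = 0 /\ b = 0.
Hypothesis hw0 : forall i, mvec B0 i = cpt rc fl x w00 w01 i.
Hypothesis hw1 : forall i, mvec B1 i = cpt rc fl x w10 w11 i.

Let D := w00 * w11 - w01 * w10.
Notation h := (hz rc fl (coefs f) x).

Lemma mvec_comb a b i : mvec (a *: B0 + b *: B1) i =
  cpt rc fl x (a * w00 + b * w10) (a * w01 + b * w11) i.
Proof.
have := hw0 i; have := hw1 i; rewrite /mvec !mxE => -> ->; rewrite /cpt.
by case: (chart rc fl i) => [[] []] /=; ring.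
Qed.

Lemma mvec_eq0 (M : 'M[Cx]_2) : (forall i, mvec M i = 0) -> M = 0.
Proof.
move=> h; have [e1 e2 e3 e4] := mvec_inord M.
by apply: mx2_eq; rewrite mxE -?e1 -?e2 -?e3 -?e4.
Qed.

Lemma pencil_D : D != 0.
Proof.
apply/eqP => D0.
have c0 a b : a * w00 + b * w10 = 0 -> a * w01 + b * w11 = 0 -> a = 0 /\ b = 0.
  move=> e1 e2; apply: hfree; apply: mvec_eq0 => i.
  by rewrite mvec_comb e1 e2 /cpt if_same mulr0.
have [||w11z w01z] := c0 w11 (- w01).
- by rewrite -[RHS]D0 /D; ring.
- by ring.
have [||w10z w00z] := c0 (- w10) w00.
- by ring.
- by rewrite -[RHS]D0 /D; ring.
have [||/eqP] := c0 1 0; rewrite ?mul1r ?mul0r ?addr0 //; last by rewrite oner_eq0.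
by apply/eqP; rewrite -oppr_eq0; apply/eqP.
Qed.

Variables (p q : Cx).
Hypothesis pq0 : (p != 0) || (q != 0).

Definition pline1 : {poly Cx} := lin (- w01) w00.
Definition pline2 : {poly Cx} := lin (p * w11 - q * w01) (q * w00 - p * w10).
(** The form [y * (p * x + q * y)] in the affine coordinate of the line; [pline1] vanishes at [B0]
    and [pline2] at [q *: B0 - p *: B1]. *)
Definition pquad : {poly Cx} := D ^- 2 *: (pline1 * pline2).

Lemma pline1_neq0 : pline1 != 0.
Proof.
apply: lin_neq0; rewrite oppr_eq0; apply: contraTT pencil_D.
by rewrite negb_or !negbK /D => /andP[/eqP-> /eqP->]; rewrite !mul0r subrr.
Qed.

Lemma pline2_coef_neq0 : (p * w11 - q * w01 != 0) || (q * w00 - p * w10 != 0).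
Proof.
apply: contraTT pq0; rewrite !negb_or !negbK => /andP[/eqP e1 /eqP e2].
have pz : p * D = 0.
  have -> : p * D = w00 * (p * w11 - q * w01) + w01 * (q * w00 - p * w10) by rewrite /D; ring.
  by rewrite e1 e2 !mulr0 addr0.
have qz : q * D = 0.
  have -> : q * D = w10 * (p * w11 - q * w01) + w11 * (q * w00 - p * w10) by rewrite /D; ring.
  by rewrite e1 e2 !mulr0 addr0.
by move/eqP: pz; move/eqP: qz; rewrite !mulf_eq0 (negPf pencil_D) !orbF => -> ->.
Qed.

Lemma pquad_neq0 : pquad != 0.
Proof.
rewrite scaler_eq0 invr_eq0 expf_eq0 (negPf pencil_D) /= mulf_neq0 ?pline1_neq0 //.
exact: lin_neq0 pline2_coef_neq0.
Qed.

Lemma size_pquad : (size pquad <= 3)%N.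
Proof.
apply: (leq_trans (size_scale_leq _ _)); apply: (leq_trans (size_polyMleq _ _)).
have := size_lin (- w01) w00; have := size_lin (p * w11 - q * w01) (q * w00 - p * w10).
rewrite -/pline1 -/pline2; lia.
Qed.

(* The point [(1, z)] of the line in the coordinates given by [B0] and [B1]. *)
Lemma gval_line j z :
  let a := (w11 - z * w10) / D in let b := (z * w00 - w01) / D in
  gval f j (a *: B0 + b *: B1) = (h j).[z] /\ b * (p * a + q * b) = pquad.[z].
Proof.
move=> a b; have D0 := pencil_D; split.
  rewrite (gval_hom j (mvec_comb a b)).
  have -> : a * w00 + b * w10 = 1 by rewrite /a /b /D; field; rewrite -/D.
  have -> : a * w01 + b * w11 = z by rewrite /a /b /D; field; rewrite -/D.
  by rewrite hom_horner // size_hz.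
have e1 : pline1.[z] = - w01 + w00 * z by rewrite /pline1 /lin !hornerE.
have e2 : pline2.[z] = p * w11 - q * w01 + (q * w00 - p * w10) * z.
  by rewrite /pline2 /lin !hornerE.
by rewrite /pquad hornerZ hornerM e1 e2 /a /b; field.
Qed.

Lemma no_line_open (j : 'I_n.+1) : (0 < j)%N ->
  (forall a b : Cx, b * (p * a + q * b) != 0 -> gval f j (a *: B0 + b *: B1) = 0) -> False.
Proof.
move=> j0 hv; have hj : h j != 0 by apply: restriction_neq0; lia.
have /eqP : h j * pquad = 0.
  apply: poly_nat_eq0 => k; rewrite hornerM.
  have [<- qE] := gval_line j k%:R.
  have [->|qz] := eqVneq pquad.[k%:R] 0; first by rewrite mulr0.
  by rewrite hv ?mul0r // qE.
by rewrite mulf_eq0 (negPf hj) (negPf pquad_neq0).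
Qed.

(** The ratio of [h j] to [pquad * h i] is real, hence constant. For [i > 0] this is the second
    event of [bad]; for [i = 0] the zeros of the last form at the roots of [pquad] give the third or
    the fourth. *)
Lemma no_line_wall (i j : 'I_n.+1) : j = i.+1 :> nat ->
  (forall a b : Cx, b * (p * a + q * b) != 0 -> exists rho : Cx, 0 < rho /\
     gval f j (a *: B0 + b *: B1) =
     - (rho * (b * (p * a + q * b)) * gval f i (a *: B0 + b *: B1))) ->
  gval f ord_max B0 = 0 -> gval f ord_max (q *: B0 - p *: B1) = 0 -> False.
Proof.
move=> ji hv gn0 gn1; have hj : h j != 0 by apply: restriction_neq0; lia.
have hz z : pquad.[z] != 0 -> exists rho : Cx, 0 < rho /\
    (h j).[z] = - (rho * (pquad * h i).[z]).
  move=> qz; have [gj qE] := gval_line j z; have [gi _] := gval_line i z.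
  have [|rho [r0 E]] := hv ((w11 - z * w10) / D) ((z * w00 - w01) / D); first by rewrite qE.
  by exists rho; split=> //; move: E; rewrite gj gi qE hornerM mulrA.
have hi : h i != 0.
  apply/eqP => hi0; have /eqP : h j * pquad = 0.
    apply: poly_nat_eq0 => k; rewrite hornerM.
    have [->|/hz[rho [_ ->]]] := eqVneq pquad.[k%:R] 0; first by rewrite mulr0.
    by rewrite hi0 mulr0 horner0 mulr0 oppr0 mul0r.
  by rewrite mulf_eq0 (negPf hj) (negPf pquad_neq0).
have [la laE] : exists la, h j = la *: (pquad * h i).
  apply: real_ratio_const => [|z]; first by rewrite mulf_neq0 ?pquad_neq0.
  have [q0|/hz[rho [r0 ->]]] := eqVneq pquad.[z] 0.
    by rewrite hornerM q0 mul0r rmorph0 !mulr0.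
  rewrite rmorphN rmorphM /= [rho^*]conj_Creal ?gtr0_real //; ring.
have la0 : la != 0 by apply: contraNneq hj => la0; rewrite laE la0 scale0r.
have [i0|i0] := posnP i; last first.
  apply: (generic (rc := rc) (fl := fl)); right; left.
  exists (i, j); split=> //; exists x, (la *: pquad); split.
    by rewrite (leq_trans (size_scale_leq _ _)) // size_pquad.
  by rewrite laE scalerAl.
have iE : i = ord0 by apply: ord_inj.
have jE : j = one d by apply: ord_inj; rewrite (val_one d3) ji i0.
have dn := dg_max_gt1.
rewrite iE jE in laE.
have [r [sr hr]] : exists r : {poly Cx}, (size r <= dg n)%N /\ h ord_max = pline1 * r.
  have dE : dg (@ord_max n) = (dg n).-1.+1 by rewrite prednK //; lia.
  have [||| r [sr hr]] := @hom_root (dg n).-1 (- w01) w00 (h ord_max).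
  - rewrite oppr_eq0; apply: contraTT pencil_D.
    by rewrite negb_or !negbK /D => /andP[/eqP-> /eqP->]; rewrite !mul0r subrr.
  - by rewrite -dE; exact: size_hz.
  - by rewrite -dE opprK -gn0 (gval_hom ord_max hw0).
  by exists r; split=> //; rewrite (leq_trans sr) // prednK //; lia.
(* For [p = 0] the two roots coincide and only one linear factor of the last form is known; a square
   root then absorbs the constants to write the quadratic factor as a square. *)
have [p0|pn] := eqVneq p 0.
  have q0 : q != 0 by move: pq0; rewrite p0 eqxx.
  have p2E : pline2 = q *: pline1.
    rewrite /pline1 /pline2 p0 !mul0r !subr0 sub0r /lin scalerDr scalerA.
    by rewrite -mulrN polyCM mul_polyC.
  pose s := sqrtC (la * D ^- 2 * q).
  have sE : s * s = la * D ^- 2 * q by rewrite -expr2 sqrtCK.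
  have s0 : s != 0 by rewrite sqrtC_eq0 !mulf_neq0 ?invr_neq0 ?expf_neq0 ?pencil_D.
  apply: (generic (rc := rc) (fl := fl)); do 3!right; left.
  exists x, (s *: pline1), (s^-1 *: r); split.
  - by rewrite (leq_trans (size_scale_leq _ _)) // size_lin.
  - by rewrite (leq_trans (size_scale_leq _ _)).
  - have -> : s *: pline1 * (s *: pline1) = (la * D ^- 2 * q) *: (pline1 * pline1).
      by rewrite -scalerAl -scalerAr scalerA sE.
    rewrite laE /pquad p2E -[pline1 * (q *: _)]scalerAr scalerA -scalerAl scalerA mulrA.
    by rewrite -scalerAr [h ord0 * _]mulrC.
  - by rewrite hr -scalerAr -scalerAl scalerA mulVf // scale1r.
have [r' [sr' hr']] : exists r' : {poly Cx}, (size r' <= (dg n).-1)%N /\ r = pline2 * r'.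
  have [m mE] : exists m, dg n = m.+2 by exists (dg n).-2; lia.
  have [||| r' [s' hr']] := @hom_root m (p * w11 - q * w01) (q * w00 - p * w10) r.
  - exact: pline2_coef_neq0.
  - by rewrite -mE.
  - have gE : gval f ord_max (q *: B0 - p *: B1) =
       hom m.+2 (h ord_max) (q * w00 - p * w10) (- (p * w11 - q * w01)).
      rewrite -scaleNr (gval_hom ord_max (mvec_comb q (- p))) -mE.
      by congr hom; ring.
    move/eqP: gn1; rewrite gE hr hom_lin -?mE // mulf_eq0 => /orP[|/eqP//].
    (* The value of the first linear factor at the second root: it is nonzero, so the cofactor [r]
       vanishes there. *)
    have -> : - w01 * (q * w00 - p * w10) + w00 * - (p * w11 - q * w01) = - (p * D).
      by rewrite /D; ring.
    by rewrite oppr_eq0 mulf_eq0 (negPf pn) (negPf pencil_D).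
  by exists r'; split=> //; rewrite mE.
have lD : la * D ^- 2 != 0 by rewrite mulf_neq0 // invr_neq0 // expf_neq0 // pencil_D.
apply: (generic (rc := rc) (fl := fl)); do 2!right; left.
exists x, (la *: pquad), ((la * D ^- 2)^-1 *: r'); split.
- by rewrite (leq_trans (size_scale_leq _ _)) // size_pquad.
- by rewrite (leq_trans (size_scale_leq _ _)).
- by rewrite laE scalerAl mulrC.
- rewrite hr hr' /pquad scalerA -scalerAr -scalerAl scalerA mulVf // scale1r mulrA //.
Qed.

End Pencil.

Lemma no_covered_line (A B : 'M[pser]_2) : ~ det_divides (f ord0) -> covline f A B -> False.
Proof.
move=> nd /covline_reduce[A0 [A1 [B0 [B1 [hc dA0 h0 h1 hfree]]]]].
have B00 : B0 != 0.
  apply/eqP => z; have E : 1 *: B0 + 0 *: B1 = 0 by rewrite z scaler0 scale0r addr0.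
  by have [/eqP] := hfree 1 0 E; rewrite oner_eq0.
case: (line_cases d3 hf hc dA0 h0 h1 hfree).
  by move=> [D [g0 g1 gn]]; exact: (no_common_zero B00 D nd g0 g1 gn).
move=> [[np [j [p [q [j0 pq hv]]]]]|[np [i [j [p [q [ji pq hv gn0 gn1]]]]]]];
  have [rc [fl [x [w00 [w01 [w10 [w11 [hw0 hw1]]]]]]]] := null_pencil_chart B00 np.
  exact: (no_line_open hfree hw0 hw1 pq j0 hv).
exact: (no_line_wall hfree hw0 hw1 pq ji hv gn0 gn1).
Qed.

End Contradiction.

Theorem theorem6p1 (d : nat) : (3 < d)%N ->
  exists P : mpoly.mpoly #|coef_idx d| Cx, P != 0 /\
  forall f : 'I_(d./2).+1 -> mpoly.mpoly 4 Cx,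
    (forall j : 'I_(d./2).+1, homog_deg (2 * j + odd d) (f j)) ->
    (forall j : 'I_(d./2).+1, ~ det_divides (f j)) ->
    mpoly.meval (coef_vec f) P != 0 ->
    ~ (exists A B : 'M[K]_2,
         is_Kline A B /\ VAL_sub (line_point A B) (in_surface f)).
Proof.
move=> d3; have [P [P0 hP]] := genericity d3.
exists P; split=> // f hf nd Pf [A [B [[/puiseux_kmx[A' AE] [/puiseux_kmx[B' BE] hfree]] hV]]].
apply: (no_covered_line d3 hf (hP f Pf) (nd ord0) (A := A') (B := B')) => l m lm; split.
  apply/eqP => E; have [|l0 m0] := hfree l m (psvP l) (psvP m).
    rewrite AE BE !kmx_scale kmx_add E.
    by apply/matrixP => i j; rewrite !mxE.
  by case/orP: lm => /eqP; apply; apply: pser_eq.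
apply: hV; exists l, m; split; first exact: psvP.
split; first exact: psvP.
split; last by rewrite AE BE !kmx_scale kmx_add.
by case/orP: lm => /eqP h; [left|right] => E; apply: h; apply: pser_eq.
Qed.
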